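(* Let $\theta_0\in(0,2\pi]$ and let $\bm{u}=u_\theta\bm{e_\theta}+u_r\bm{e_r}\in C^2(\overline{\Omega_{1,2,\theta_0}})$, with pressure $P$, be a solution of the stationary Euler equations in $\Omega_{1,2,\theta_0}$ satisfying $|u_r|>0$ in $\overline{\Omega_{1,2,\theta_0}}$. Assume there exist constants $c_1,c_2\in\mathbb{R}$ such that $$u_\theta(r,0)=\frac{c_1}{r},\qquad u_\theta(r,\theta_0)=\frac{c_2}{r}\qquad (1\le r\le 2),$$ and that for all $\theta\in[0,\theta_0]$ $$u_r(1,\theta)=2u_r(2,\theta),\qquad u_\theta(1,\theta)=2u_\theta(2,\theta),\qquad \partial_r u_\theta(1,\theta)=4\,\partial_r u_\theta(2,\theta).$$ Then $c_1=c_2=:c$, and the following hold. (i) If $c=0$, then $\bm{u}$ is $(-1)$-homogeneous, $P$ is $(-2)$-homogeneous up to a constant translation, and there are constants $b\neq 0$ and $C$ such that $\bm{u}=\frac{b}{r}\bm{e_r}$ and $P=-\frac{b^2}{2r^2}+C$. (ii) If $c\neq 0$, assume in addition that for some constant $A$ either $\partial_\theta(ru_r)=A$ along $\{\theta=0\}$ or $\partial_\theta(ru_r)=A$ along $\{\theta=\theta_0\}$. Then $\bm{u}$ is $(-1)$-homogeneous, $P$ is $(-2)$-homogeneous up to a constant translation, and there are constants $v,p,C$ and a function $f\in C^2([0,\theta_0])$ that is strictly sign-definite on $[0,\theta_0]$ such that $$\bm{u}=\frac{v}{r}\bm{e_\theta}+\frac{f(\theta)}{r}\bm{e_r},\qquad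 P=\frac{p}{r^2}+C,\qquad v f'(\theta)=f(\theta)^2+v^2+2p .$$
   Context: $(r,\theta)$ are polar coordinates in $\mathbb{R}^2$, $\bm{e_r}=(\cos\theta,\sin\theta)^T$, $\bm{e_\theta}=(-\sin\theta,\cos\theta)^T$, and a planar vector field is written $\bm{u}=u_\theta\bm{e_\theta}+u_r\bm{e_r}$. For $0\le a<b\le\infty$ and $\theta_0\in(0,2\pi]$, $\Omega_{a,b,\theta_0}=\{(r,\theta): a<r<b,\ 0<\theta<\theta_0\}$. Functions and fields on $\overline{\Omega_{1,2,\theta_0}}$ are regarded as functions of $(r,\theta)\in[1,2]\times[0,\theta_0]$, with regularity up to the boundary in these coordinates. The stationary Euler equations in $\Omega$ are $\bm{u}\cdot\nabla\bm{u}=-\nabla P$, $\operatorname{div}\bm{u}=0$ in $\Omega$, with $\bm{u}$ the velocity and $P$ a scalar (pressure) function on $\Omega$; $\bm{u}$ is called a solution if these hold with some pressure $P$. $\bm{u}$ is $(-\alpha)$-homogeneous if $\bm{u}=\frac{v(\theta)}{r^\alpha}\bm{e_\theta}+\frac{f(\theta)}{r^\alpha}\bm{e_r}$ for some functions $v,f$ of $\theta$ only; $P$ is $(-2\alpha)$-homogeneous up to a constant translation if $P-C$ is $r^{-2\alpha}$ times a function of $\theta$ for some constant $C$. A function is strictly sign-definite on a set if it is everywhere positive or everywhere negative there. *)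

(* Defs.v *)
From Stdlib Require Import Reals.
From Coquelicot Require Import Coquelicot.
Open Scope R_scope.

(* Derivative relative to [a, b]: two-sided in the interior, one-sided at the
   end points.  Only the values of [f] on [a, b] matter when [a <= x <= b]. *)
Definition is_derive_on (a b : R) (f : R -> R) (x l : R) : Prop :=
  filterdiff f (within (fun y => a <= y <= b) (locally x)) (fun h => scal h l).

Definition ex_derive_on (a b : R) (f : R -> R) (x : R) : Prop :=
  exists l, is_derive_on a b f x l.

(* Total operator: it is the derivative where one exists and is unique (for
   [a < b] and [x] in [a, b], existence suffices), and unspecified otherwise. *)
Definition Derive_on (a b : R) (f : R -> R) (x : R) : R :=
  iota (is_derive_on a b f x).

Fixpoint Ck_interval (k : nat) (a b : R) (f : R -> R) : Prop :=
  continuous_on (fun x => a <= x <= b) f /\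
  match k with
  | O => True
  | S k' =>
      (forall x, a <= x <= b -> ex_derive_on a b f x) /\
      Ck_interval k' a b (Derive_on a b f)
  end.

Definition partial_r (a b : R) (g : R -> R -> R) (r theta : R) : R :=
  Derive_on a b (fun s => g s theta) r.

Definition partial_theta (theta0 : R) (g : R -> R -> R) (r theta : R) : R :=
  Derive_on 0 theta0 (fun t => g r t) theta.

Definition Omega (a b theta0 r theta : R) : Prop :=
  a < r < b /\ 0 < theta < theta0.

(* The two edges [theta = 0] and [theta = theta0] stay distinct, also when
   [theta0 = 2 * PI]. *)
Definition Omega_closed (a b theta0 r theta : R) : Prop :=
  a <= r <= b /\ 0 <= theta <= theta0.

Fixpoint Ck_sector (k : nat) (a b theta0 : R) (g : R -> R -> R) : Prop :=
  continuous_on (fun z : R * R => Omega_closed a b theta0 (fst z) (snd z))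
                (fun z : R * R => g (fst z) (snd z)) /\
  match k with
  | O => True
  | S k' =>
      (forall r theta, Omega_closed a b theta0 r theta ->
         ex_derive_on a b (fun s => g s theta) r /\
         ex_derive_on 0 theta0 (fun t => g r t) theta) /\
      Ck_sector k' a b theta0 (partial_r a b g) /\
      Ck_sector k' a b theta0 (partial_theta theta0 g)
  end.

Definition e_r (theta : R) : R * R := (cos theta, sin theta).
Definition e_theta (theta : R) : R * R := (- sin theta, cos theta).

Definition vfield (u_theta u_r : R -> R -> R) (r theta : R) : R * R :=
  plus (scal (u_theta r theta) (e_theta theta)) (scal (u_r r theta) (e_r theta)).

Definition Dx (g : R -> R -> R) (x y : R) : R := Derive (fun s => g s y) x.
Definition Dy (g : R -> R -> R) (x y : R) : R := Derive (fun s => g x s) y.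

(* Here [x], [y] are Cartesian coordinates and [(U1, U2)] are the Cartesian
   components of the velocity. *)
Definition euler_at (U1 U2 Q : R -> R -> R) (x y : R) : Prop :=
  (differentiable_pt U1 x y /\ differentiable_pt U2 x y /\
   differentiable_pt Q x y) /\
  U1 x y * Dx U1 x y + U2 x y * Dy U1 x y = - Dx Q x y /\
  U1 x y * Dx U2 x y + U2 x y * Dy U2 x y = - Dy Q x y /\
  Dx U1 x y + Dy U2 x y = 0.

(* [u_theta], [u_r] and [P] are functions of (r, theta); [U1], [U2], [Q] are
   the same field and pressure as functions of the point of the plane.  For
   [0 <= a] and [theta0 <= 2 * PI] polar coordinates are injective on the open
   sector and its image is open, so [U1], [U2], [Q] are determined there, and
   so are their derivatives. *)
Definition euler_solution (a b theta0 : R) (u_theta u_r P : R -> R -> R) : Prop :=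
  exists U1 U2 Q : R -> R -> R,
    forall r theta, Omega a b theta0 r theta ->
      let x := r * cos theta in
      let y := r * sin theta in
      (U1 x y, U2 x y) = vfield u_theta u_r r theta /\
      Q x y = P r theta /\
      euler_at U1 U2 Q x y.

(* (-alpha)-homogeneity of a velocity field given on the closed sector. *)
Definition homogeneous_velocity (alpha a b theta0 : R)
    (u : R -> R -> R * R) : Prop :=
  exists v f : R -> R,
    forall r theta, Omega_closed a b theta0 r theta ->
      u r theta = plus (scal (v theta / Rpower r alpha) (e_theta theta))
                       (scal (f theta / Rpower r alpha) (e_r theta)).

(* (-2 alpha)-homogeneity up to a constant of a pressure given on the open
   sector. *)
Definition homogeneous_pressure (alpha a b theta0 : R) (P : R -> R -> R) : Prop :=
  exists (C : R) (q : R -> R),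
    forall r theta, Omega a b theta0 r theta ->
      P r theta - C = Rpower r (- (2 * alpha)) * q theta.

Definition strictly_sign_definite (D : R -> Prop) (f : R -> R) : Prop :=
  (forall x, D x -> 0 < f x) \/ (forall x, D x -> f x < 0).

(* Main.v *)
Require Import Defs.
From Stdlib Require Import Reals Lra.
From Coquelicot Require Import Coquelicot.
Open Scope R_scope.

(** Put [f = r u_r], [v = r u_theta] and [D = r d/dr], the derivative in [ln r].
    Incompressibility is [D f + d_t v = 0], where [d_t] is the angular
    derivative, and the boundary conditions say that [f], [v], [D v] take the
    same values at [r = 1] and [r = 2], while [v] is the constant [c1] on one
    edge and [c2] on the other.  The homogeneous solutions are those with [v]
    constant and [f] a function of the angle.

    Everything rests on the divergence theorem on this periodic strip
    ([periodic_flux]).  Applied to [(f, v)] it gives [c1 = c2 = c].  The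
    vorticity is [W / r ^ 2] with [W = D v - d_t f], and its conservation along
    the flow reads [f D W + v d_t W = 2 f W] ([vorticity_transport]).

    If [c = 0], the flux [(f W ^ 2, v W ^ 2)] has divergence [4 f W ^ 2] and does
    not cross the edges; as [f] has a constant sign, [W = 0]
    ([vorticity_zero]).  If [c <> 0], let [phi] be the angular primitive of [f]
    vanishing on the edge where [d_t f = A].  Then [D phi = c - v], so that
    [Z = W exp (- 2 phi / c) + A] is constant along the flow; it vanishes on
    that edge, and a suitably weighted [Z ^ 2] gives a field whose divergence
    and edge flux have opposite signs, hence [Z = 0]
    ([vorticity_profile]).  In both cases [c d_t W = 2 f W].

    Combined with the transport equation, this relation says exactly that
    [g = c - v] and [f] satisfy [f Lap g = g Lap f] for the Laplacian in
    [(ln r, t)].  Since [f] has no zero and [g] vanishes on the edges,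
    integrating [f ^ 2 |grad (g / f)| ^ 2], the divergence of
    [(g / f) (f grad g - g grad f)], gives [g = 0] ([angular_rigidity]).  So
    [v = c], and the form of [f] and of the pressure follows by separation of
    variables ([jeffery_hamel_profile]). *)

(** * Functions of class C1 on a strip *)

(** [cont2 g]: [g] is continuous on the whole plane. *)
Definition cont2 (g : R -> R -> R) : Prop := forall x y, continuity_2d_pt g x y.

(** [C1_strip th0 g gr gt]: [gr] and [gt] are the partial derivatives of [g], all
    three being continuous up to the boundary of the sector.  The encoding uses
    functions on the whole plane, to be thought of as functions on
    [[1, 2] x [0, th0]] extended by their values at the nearest point, so that
    continuity needs no side condition.  The derivative in [r] is claimed
    wherever [1 < r < 2], hence also on the two edges; the one in [t] wherever
    [0 < t < th0], hence also on the two arcs. *)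
Record C1_strip (th0 : R) (g gr gt : R -> R -> R) : Prop := {
  C1_cont : cont2 g;
  C1_cont_r : cont2 gr;
  C1_cont_t : cont2 gt;
  C1_der_r : forall r t, 1 < r < 2 -> is_derive (fun s => g s t) r (gr r t);
  C1_der_t : forall r t, 0 < t < th0 -> is_derive (fun s => g r s) t (gt r t)
}.

Lemma cont2_const c : cont2 (fun _ _ => c).
Proof. intros x y; apply continuity_2d_pt_const. Qed.

Lemma cont2_plus f g : cont2 f -> cont2 g -> cont2 (fun r t => f r t + g r t).
Proof. intros Hf Hg x y; now apply continuity_2d_pt_plus. Qed.

Lemma cont2_minus f g : cont2 f -> cont2 g -> cont2 (fun r t => f r t - g r t).
Proof. intros Hf Hg x y; now apply continuity_2d_pt_minus. Qed.

Lemma cont2_opp f : cont2 f -> cont2 (fun r t => - f r t).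
Proof. intros Hf x y; now apply continuity_2d_pt_opp. Qed.

Lemma cont2_mult f g : cont2 f -> cont2 g -> cont2 (fun r t => f r t * g r t).
Proof. intros Hf Hg x y; now apply continuity_2d_pt_mult. Qed.

Lemma cont2_inv f : cont2 f -> (forall r t, f r t <> 0) -> cont2 (fun r t => / f r t).
Proof. intros Hf H0 x y; now apply continuity_2d_pt_inv. Qed.

Lemma cont2_comp h f :
  (forall x, continuity_pt h x) -> cont2 f -> cont2 (fun r t => h (f r t)).
Proof. intros Hh Hf x y; apply continuity_1d_2d_pt_comp; auto. Qed.

Lemma cont2_slice_t f r : cont2 f -> forall t, continuous (f r) t.
Proof.
  intros Hf t. apply continuity_pt_filterlim.
  intros eps Heps. destruct (Hf r t (mkposreal eps Heps)) as [d Hd].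
  exists d; split. apply cond_pos.
  intros s [_ Hs]. apply Hd; auto. rewrite Rminus_diag, Rabs_R0. apply cond_pos.
Qed.

Lemma cont2_slice_r f t : cont2 f -> forall r, continuous (fun s => f s t) r.
Proof.
  intros Hf r. apply continuity_pt_filterlim.
  intros eps Heps. destruct (Hf r t (mkposreal eps Heps)) as [d Hd].
  exists d; split. apply cond_pos.
  intros s [_ Hs]. apply (Hd s t); auto. rewrite Rminus_diag, Rabs_R0. apply cond_pos.
Qed.

Ltac cont2_tac :=
  repeat first [ assumption | apply cont2_const | apply cont2_plus
               | apply cont2_minus | apply cont2_opp | apply cont2_mult ].

Lemma C1_const th0 c : C1_strip th0 (fun _ _ => c) (fun _ _ => 0) (fun _ _ => 0).
Proof. split; cont2_tac; intros; apply @is_derive_const. Qed.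

Lemma C1_plus th0 f fr ft g gr gt :
  C1_strip th0 f fr ft -> C1_strip th0 g gr gt ->
  C1_strip th0 (fun r t => f r t + g r t) (fun r t => fr r t + gr r t)
     (fun r t => ft r t + gt r t).
Proof. intros [] []; split; cont2_tac; intros;
  [ apply (is_derive_plus (fun s => f s t) (fun s => g s t))
  | apply (is_derive_plus (f r) (g r)) ]; auto.
Qed.

Lemma C1_minus th0 f fr ft g gr gt :
  C1_strip th0 f fr ft -> C1_strip th0 g gr gt ->
  C1_strip th0 (fun r t => f r t - g r t) (fun r t => fr r t - gr r t)
     (fun r t => ft r t - gt r t).
Proof. intros [] []; split; cont2_tac; intros;
  [ apply (is_derive_minus (fun s => f s t) (fun s => g s t))
  | apply (is_derive_minus (f r) (g r)) ]; auto.
Qed.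

Lemma C1_mult th0 f fr ft g gr gt :
  C1_strip th0 f fr ft -> C1_strip th0 g gr gt ->
  C1_strip th0 (fun r t => f r t * g r t)
     (fun r t => fr r t * g r t + f r t * gr r t)
     (fun r t => ft r t * g r t + f r t * gt r t).
Proof.
  intros [] []; split; cont2_tac; intros;
  [ apply (Derive.is_derive_mult (fun s => f s t) (fun s => g s t))
  | apply (Derive.is_derive_mult (f r) (g r)) ]; auto.
Qed.

Lemma C1_opp th0 f fr ft :
  C1_strip th0 f fr ft ->
  C1_strip th0 (fun r t => - f r t) (fun r t => - fr r t) (fun r t => - ft r t).
Proof. intros []; split; cont2_tac; intros;
  [ apply (is_derive_opp (fun s => f s t)) | apply (is_derive_opp (f r)) ]; auto.
Qed.

Lemma C1_inv th0 f fr ft :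
  C1_strip th0 f fr ft -> (forall r t, f r t <> 0) ->
  C1_strip th0 (fun r t => / f r t) (fun r t => - fr r t * (/ f r t * / f r t))
     (fun r t => - ft r t * (/ f r t * / f r t)).
Proof.
  intros [] H0. pose proof (cont2_inv _ C1_cont0 H0).
  split; cont2_tac; intros.
  - replace (- fr r t * _) with (- fr r t / f r t ^ 2) by (field; auto).
    apply (is_derive_inv (fun s => f s t)); auto.
  - replace (- ft r t * _) with (- ft r t / f r t ^ 2) by (field; auto).
    apply (is_derive_inv (fun s => f r s)); auto.
Qed.

Lemma C1_exp th0 f fr ft :
  C1_strip th0 f fr ft ->
  C1_strip th0 (fun r t => exp (f r t)) (fun r t => fr r t * exp (f r t))
     (fun r t => ft r t * exp (f r t)).
Proof.
  intros [].
  assert (cont2 (fun r t => exp (f r t))).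
  { apply (cont2_comp exp); auto. intros x.
    apply derivable_continuous_pt, derivable_pt_exp. }
  split; cont2_tac; intros.
  - apply (is_derive_comp exp (fun s => f s t)); auto. apply is_derive_exp.
  - apply (is_derive_comp exp (fun s => f r s)); auto. apply is_derive_exp.
Qed.

(** * Integrals depending on a parameter, and the flux lemma *)

Lemma ex_RInt_cont2 F r a b : cont2 F -> ex_RInt (F r) a b.
Proof.
  intros HF. apply (@ex_RInt_continuous R_CompleteNormedModule).
  intros; now apply cont2_slice_t.
Qed.

Lemma Rabs_RInt_le f a b M :
  ex_RInt f a b ->
  (forall t, Rmin a b <= t <= Rmax a b -> Rabs (f t) <= M) ->
  Rabs (RInt f a b) <= M * Rabs (b - a).
Proof.
  intros Hex HM. destruct (Rle_dec a b) as [Hab|Hab].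
  - rewrite Rmin_left, Rmax_right in HM by lra.
    rewrite (Rabs_right (b - a)) by lra. rewrite Rmult_comm.
    now apply abs_RInt_le_const.
  - rewrite Rmin_right, Rmax_left in HM by lra.
    assert (Hex' : ex_RInt f b a) by now apply ex_RInt_swap.
    rewrite <- (opp_RInt_swap f b a) by auto.
    change (opp (RInt f b a)) with (- RInt f b a).
    rewrite Rabs_Ropp, (Rabs_left (b - a)) by lra.
    replace (M * - (b - a)) with ((a - b) * M) by ring.
    apply abs_RInt_le_const; auto; lra.
Qed.

(** A primitive in the second variable is jointly continuous; uniform continuity
    on a segment controls the dependence on the first variable. *)
Lemma cont2_RInt F e : cont2 F -> cont2 (fun r x => RInt (F r) e x).
Proof.
  intros HF r1 x1 eps.
  (* The difference splits into the integral of [F r - F r1] over a fixed segment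
     and the integral of the bounded function [F r] over a short one. *)
  set (K := Rabs (x1 - e) + 1).
  assert (HK : 0 < K) by (unfold K; pose proof (Rabs_pos (x1 - e)); lra).
  assert (He1 : 0 < eps / 2 / K).
  { pose proof (cond_pos eps). repeat apply Rdiv_lt_0_compat; lra. }
  destruct (uniform_continuity_2d_1d' F (Rmin e x1) (Rmax e x1) r1
              (fun x _ => HF r1 x) (mkposreal _ He1)) as [d1 Hd1].
  destruct (HF r1 x1 (mkposreal 1 Rlt_0_1)) as [d2 Hd2]. simpl in Hd1, Hd2.
  set (B := Rabs (F r1 x1) + 1).
  assert (HB : 0 < B) by (unfold B; pose proof (Rabs_pos (F r1 x1)); lra).
  assert (Hd : 0 < Rmin (Rmin d1 d2) (eps / 2 / B)).
  { pose proof (cond_pos eps); pose proof (cond_pos d1); pose proof (cond_pos d2).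
    repeat apply Rmin_glb_lt; auto. repeat apply Rdiv_lt_0_compat; lra. }
  exists (mkposreal _ Hd). intros r x Hr Hx. simpl in Hr, Hx.
  pose proof (Rmin_l (Rmin d1 d2) (eps / 2 / B)).
  pose proof (Rmin_r (Rmin d1 d2) (eps / 2 / B)).
  pose proof (Rmin_l d1 d2). pose proof (Rmin_r d1 d2).
  assert (Hsplit : RInt (F r) e x - RInt (F r1) e x1 =
    RInt (fun t => F r t - F r1 t) e x1 + RInt (F r) x1 x).
  { rewrite (RInt_minus (F r) (F r1)) by (now apply ex_RInt_cont2).
    rewrite <- (RInt_Chasles (F r) e x1 x) by (now apply ex_RInt_cont2).
    unfold plus, minus, opp; simpl. unfold plus; simpl. ring. }
  rewrite Hsplit.
  assert (H3 : Rabs (RInt (fun t => F r t - F r1 t) e x1) <= eps / 2 / K * Rabs (x1 - e)).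
  { apply Rabs_RInt_le.
    - apply (@ex_RInt_minus R_CompleteNormedModule); now apply ex_RInt_cont2.
    - intros t Ht. left. apply Hd1; auto.
      + pose proof (cond_pos d1); lra.
      + apply Rabs_lt_between' in Hr. lra.
      + rewrite Rminus_diag, Rabs_R0. apply cond_pos. }
  assert (H4 : Rabs (RInt (F r) x1 x) <= B * Rabs (x - x1)).
  { apply Rabs_RInt_le. now apply ex_RInt_cont2.
    intros t Ht.
    assert (Ht' : Rabs (t - x1) < d2).
    { apply Rle_lt_trans with (Rabs (x - x1)); [|lra].
      destruct (Rle_dec x1 x).
      - rewrite Rmin_left, Rmax_right in Ht by lra.
        rewrite !Rabs_right by lra. lra.
      - rewrite Rmin_right, Rmax_left in Ht by lra.
        rewrite !Rabs_left1 by lra. lra. }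
    specialize (Hd2 r t ltac:(lra) Ht').
    replace (F r t) with (F r t - F r1 x1 + F r1 x1) by ring.
    eapply Rle_trans. apply Rabs_triang. unfold B. lra. }
  assert (H5 : eps / 2 / K * Rabs (x1 - e) < eps / 2).
  { replace (eps / 2) with (eps / 2 / K * K) at 2 by (field; lra).
    apply Rmult_lt_compat_l; auto. unfold K. lra. }
  assert (H6 : B * Rabs (x - x1) < eps / 2).
  { replace (eps / 2) with (B * (eps / 2 / B)) by (field; lra).
    apply Rmult_lt_compat_l; auto. lra. }
  eapply Rle_lt_trans. apply Rabs_triang. lra.
Qed.

Lemma is_derive_RInt_r (F Fr : R -> R -> R) a b r :
  cont2 F -> cont2 Fr -> 1 < r < 2 ->
  (forall s t, 1 < s < 2 -> is_derive (fun s => F s t) s (Fr s t)) ->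
  is_derive (fun s => RInt (F s) a b) r (RInt (Fr r) a b).
Proof.
  intros HF HFr Hr Hd.
  assert (Hloc : locally r (fun s => 1 < s < 2)).
  { apply (open_and (fun s => 1 < s) (fun s => s < 2)); auto.
    apply open_gt. apply open_lt. }
  rewrite (RInt_ext (Fr r) (fun t => Derive (fun s => F s t) r)).
  2: { intros t _. symmetry. apply is_derive_unique. auto. }
  apply (is_derive_RInt_param F a b r).
  - eapply filter_imp; [|exact Hloc]. intros s Hs t _. exists (Fr s t). auto.
  - intros t _. apply (continuity_2d_pt_ext_loc Fr); [|apply HFr].
    destruct Hloc as [d Hloc]. exists d. intros u v Hu Hv.
    symmetry. apply is_derive_unique. apply Hd. apply Hloc. exact Hu.
  - apply filter_forall. intros s. now apply ex_RInt_cont2.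
Qed.

Lemma is_derive_RInt_t F r e t :
  cont2 F -> is_derive (fun x => RInt (F r) e x) t (F r t).
Proof.
  intros HF. apply (@is_derive_RInt R_NormedModule (F r) _ e t).
  - apply filter_forall. intros x. apply (@RInt_correct R_CompleteNormedModule).
    now apply ex_RInt_cont2.
  - now apply cont2_slice_t.
Qed.

(** Mean value theorem with the derivative required in the open interval only. *)
Lemma MVT_open (f df : R -> R) a b :
  a < b -> (forall x, continuous f x) ->
  (forall x, a < x < b -> is_derive f x (df x)) ->
  exists c, a < c < b /\ f b - f a = df c * (b - a).
Proof.
  intros Hab Hc Hd.
  assert (pr : forall c, a < c < b -> derivable_pt f c).
  { intros c Hcc. exists (df c). apply is_derive_Reals. auto. }
  destruct (MVT f id a b pr (fun c _ => derivable_pt_id c) Hab) as [c [P H]].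
  - intros x _. apply continuity_pt_filterlim. apply Hc.
  - intros x _. apply derivable_continuous_pt, derivable_pt_id.
  - exists c; split; auto. rewrite derive_pt_id in H. unfold id in H.
    rewrite (Derive_Reals f c (pr c P)), (is_derive_unique f c (df c)) in H by auto.
    lra.
Qed.

(** A function continuous on the line and with vanishing derivative on an open
    interval takes one value on the closure. *)
Lemma derive_zero_const f a b :
  (forall x, continuous f x) -> (forall x, a < x < b -> is_derive f x 0) ->
  forall x y, a <= x <= b -> a <= y <= b -> f x = f y.
Proof.
  intros Hc Hd.
  assert (Hlt : forall x y, a <= x -> x < y -> y <= b -> f x = f y).
  { intros x y H1 H2 H3.
    destruct (MVT_open f (fun _ => 0) x y) as [c [_ H]]; auto.
    intros; apply Hd; lra. lra. }
  intros x y Hx Hy. destruct (Rtotal_order x y) as [H|[->|H]]; auto.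
  apply Hlt; lra. symmetry; apply Hlt; lra.
Qed.

(** Fundamental theorem of calculus with the derivative required in the open
    interval only. *)
Lemma FTC_open (G g : R -> R) a b :
  a < b -> (forall x, continuous G x) -> (forall x, continuous g x) ->
  (forall x, a < x < b -> is_derive G x (g x)) ->
  RInt g a b = G b - G a.
Proof.
  intros Hab HG Hg Hd.
  assert (H : (fun x => RInt g a x - G x) a = (fun x => RInt g a x - G x) b).
  { assert (Hi : forall x, is_derive (fun x => RInt g a x) x (g x)).
    { intros x. apply (@is_derive_RInt R_NormedModule g _ a x); auto.
      apply filter_forall. intros y. apply (@RInt_correct R_CompleteNormedModule).
      apply (@ex_RInt_continuous R_CompleteNormedModule). auto. }
    apply (derive_zero_const (fun x => RInt g a x - G x) a b); try lra.
    - intros x. apply (@continuous_minus _ _ R_NormedModule); auto.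
      apply (@ex_derive_continuous R_AbsRing R_NormedModule). exists (g x). auto.
    - intros x Hx. replace 0 with (g x - g x) by ring.
      apply @is_derive_minus; auto. }
  simpl in H. rewrite RInt_point in H. unfold zero in H; simpl in H. lra.
Qed.

(** A nondecreasing function with equal end values has zero derivative. *)
Lemma monotone_loop_derive_zero f df a b :
  a < b -> (forall x, continuous f x) ->
  (forall x, a < x < b -> is_derive f x (df x)) ->
  (forall x, a < x < b -> 0 <= df x) ->
  f a = f b -> forall x, a < x < b -> df x = 0.
Proof.
  intros Hab Hc Hd Hpos Hloop.
  assert (Hmono : forall x y, a <= x -> x < y -> y <= b -> f x <= f y).
  { intros x y H1 H2 H3.
    destruct (MVT_open f df x y) as [c [Hc' H]]; auto.
    intros; apply Hd; lra.
    assert (0 <= df c * (y - x)); [|lra].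
    apply Rmult_le_pos; [apply Hpos|]; lra. }
  assert (Hconst : forall x, a < x < b -> f x = f a).
  { intros x Hx. pose proof (Hmono a x). pose proof (Hmono x b). lra. }
  intros x Hx. rewrite <- (is_derive_unique f x (df x)) by auto.
  apply is_derive_unique.
  apply (is_derive_ext_loc (fun _ => f a)); [|apply @is_derive_const].
  assert (Hloc : locally x (fun s => a < s < b)).
  { apply (open_and (fun s => a < s) (fun s => s < b)); auto.
    apply open_gt. apply open_lt. }
  eapply filter_imp; [|exact Hloc]. intros y Hy. symmetry. now apply Hconst.
Qed.

(** A continuous nonnegative function with zero integral vanishes: its primitive
    is a nondecreasing function with equal end values. *)
Lemma RInt_zero_nonneg g a b :
  a < b -> (forall x, continuous g x) -> (forall x, a < x < b -> 0 <= g x) ->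
  RInt g a b = 0 -> forall x, a < x < b -> g x = 0.
Proof.
  intros Hab Hg Hpos H0.
  assert (Hi : forall x, is_derive (fun x => RInt g a x) x (g x)).
  { intros x. apply (@is_derive_RInt R_NormedModule g _ a x); auto.
    apply filter_forall. intros y. apply (@RInt_correct R_CompleteNormedModule).
    apply (@ex_RInt_continuous R_CompleteNormedModule). auto. }
  apply (monotone_loop_derive_zero (fun x => RInt g a x)); auto.
  - intros x. apply (@ex_derive_continuous R_AbsRing R_NormedModule).
    exists (g x). auto.
  - rewrite RInt_point, H0. reflexivity.
Qed.

(** The tool behind every step of the proof.  In the coordinates
    [(ln r, t)], [r * Fr + Gt] is the divergence of [(F, G)]; if [F] takes the
    same values on the two arcs, the integral of this divergence equals the flux
    of [G] through the two edges.  When the divergence is nonnegative and that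
    flux nonpositive, both vanish.  The proof shows that
    the integral of [F] over an arc is nondecreasing in [r]. *)
Lemma periodic_flux th0 F Fr Ft G Gr Gt :
  0 < th0 -> C1_strip th0 F Fr Ft -> C1_strip th0 G Gr Gt ->
  (forall t, 0 < t < th0 -> F 1 t = F 2 t) ->
  (forall r t, 1 < r < 2 -> 0 < t < th0 -> 0 <= r * Fr r t + Gt r t) ->
  (forall r, 1 < r < 2 -> G r th0 <= G r 0) ->
  (forall r t, 1 < r < 2 -> 0 < t < th0 -> r * Fr r t + Gt r t = 0) /\
  (forall r, 1 < r < 2 -> G r th0 = G r 0).
Proof.
  intros Hth [HF HFr _ HdF _] [HG _ HGt _ HdG] Hper Hpos Hedge.
  set (I := fun r => RInt (fun t => r * Fr r t + Gt r t) 0 th0).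
  assert (HcS : forall r, forall t, continuous (fun t => r * Fr r t + Gt r t) t).
  { intros r t. apply (@continuous_plus _ _ R_NormedModule).
    apply (@continuous_scal_r _ _ R_NormedModule r). all: now apply cont2_slice_t. }
  assert (HI : forall r, I r = r * RInt (Fr r) 0 th0 + (G r th0 - G r 0)).
  { intros r. unfold I. rewrite (RInt_plus (fun t => r * Fr r t) (Gt r)).
    - assert (E : RInt (fun t => r * Fr r t) 0 th0 = r * RInt (Fr r) 0 th0).
      { apply (@RInt_scal R_CompleteNormedModule (Fr r)). now apply ex_RInt_cont2. }
      rewrite E.
      rewrite (FTC_open (G r) (Gt r)); auto; now apply cont2_slice_t.
    - apply (@ex_RInt_scal R_CompleteNormedModule). now apply ex_RInt_cont2.
    - now apply ex_RInt_cont2. }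
  assert (HIpos : forall r, 1 < r < 2 -> 0 <= I r).
  { intros r Hr. apply RInt_ge_0; auto; try lra.
    apply (@ex_RInt_continuous R_CompleteNormedModule); auto. }
  (* [RInt (Fr r) 0 th0] is the derivative of the integral of [F] over an arc. *)
  assert (HJ : forall r, 1 < r < 2 -> RInt (Fr r) 0 th0 = 0).
  { apply (monotone_loop_derive_zero (fun r => RInt (F r) 0 th0)); try lra.
    - intros r. apply (cont2_slice_r (fun r x => RInt (F r) 0 x) th0).
      now apply cont2_RInt.
    - intros r Hr. now apply is_derive_RInt_r.
    - intros r Hr. specialize (HI r). specialize (HIpos r Hr). specialize (Hedge r Hr).
      apply Rmult_le_reg_l with r; lra.
    - apply RInt_ext. rewrite Rmin_left, Rmax_right by lra. auto. }
  split.
  - intros r t Hr Ht.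
    apply (RInt_zero_nonneg (fun t => r * Fr r t + Gt r t) 0 th0); auto.
    change (I r = 0). specialize (HI r). specialize (HIpos r Hr).
    specialize (Hedge r Hr). rewrite HJ in HI by auto. lra.
  - intros r Hr. specialize (HI r). specialize (HIpos r Hr).
    specialize (Hedge r Hr). rewrite HJ in HI by auto. lra.
Qed.

(** * One-sided derivatives and fields on the closed sector *)

Lemma locally_open_interval a b x : a < x < b -> locally x (fun s => a < s < b).
Proof.
  intros Hx. apply (open_and (fun s => a < s) (fun s => s < b)); auto.
  apply open_gt. apply open_lt.
Qed.

(** The meaning of a relative derivative in terms of inequalities. *)
Lemma is_derive_on_elim a b f x l :
  a <= x <= b -> is_derive_on a b f x l ->
  forall eps : posreal, locally x (fun y => a <= y <= b ->
    Rabs (f y - f x - (y - x) * l) <= eps * Rabs (y - x)).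
Proof.
  intros Hx [_ H] eps. refine (H x _ eps).
  intros Q HQ. unfold within. eapply filter_imp; [|exact HQ]. auto.
Qed.

(** Uniqueness holds at the end points too, as every point of a nontrivial
    interval is a limit of other points of it. *)
Lemma is_derive_on_unique a b f x l1 l2 :
  a < b -> a <= x <= b -> is_derive_on a b f x l1 -> is_derive_on a b f x l2 -> l1 = l2.
Proof.
  intros Hab Hx H1 H2. apply Req_lt_aux. intros eps.
  assert (He : 0 < eps / 4) by (pose proof (cond_pos eps); lra).
  pose proof (filter_and _ _ (is_derive_on_elim _ _ _ _ _ Hx H1 (mkposreal _ He))
                (is_derive_on_elim _ _ _ _ _ Hx H2 (mkposreal _ He))) as [d Hd].
  simpl in Hd. pose proof (cond_pos d) as Hdp.
  assert (Hy : exists y, a <= y <= b /\ Rabs (y - x) < d /\ 0 < Rabs (y - x)).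
  { destruct (Rlt_dec x b) as [Hxb|Hxb].
    - exists (x + Rmin (d / 2) (b - x)).
      assert (0 < Rmin (d / 2) (b - x)) by (apply Rmin_glb_lt; lra).
      pose proof (Rmin_l (d / 2) (b - x)). pose proof (Rmin_r (d / 2) (b - x)).
      replace (x + _ - x) with (Rmin (d / 2) (b - x)) by ring.
      rewrite Rabs_right by lra. lra.
    - exists (x - Rmin (d / 2) (x - a)).
      assert (0 < Rmin (d / 2) (x - a)) by (apply Rmin_glb_lt; lra).
      pose proof (Rmin_l (d / 2) (x - a)). pose proof (Rmin_r (d / 2) (x - a)).
      replace (x - _ - x) with (- Rmin (d / 2) (x - a)) by ring.
      rewrite Rabs_Ropp, Rabs_right by lra. lra. }
  destruct Hy as [y [Hyab [Hyd Hy0]]].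
  destruct (Hd y Hyd) as [K1 K2]. specialize (K1 Hyab). specialize (K2 Hyab).
  apply Rmult_lt_reg_r with (Rabs (y - x)); auto.
  rewrite <- Rabs_mult.
  replace ((l1 - l2) * (y - x)) with
    ((f y - f x - (y - x) * l2) - (f y - f x - (y - x) * l1)) by ring.
  eapply Rle_lt_trans. apply Rabs_triang. rewrite Rabs_Ropp.
  assert (0 < eps * Rabs (y - x)) by (apply Rmult_lt_0_compat; auto; apply cond_pos).
  lra.
Qed.

Lemma Derive_on_correct a b f x :
  a < b -> a <= x <= b -> ex_derive_on a b f x ->
  is_derive_on a b f x (Derive_on a b f x).
Proof.
  intros Hab Hx [l Hl]. unfold Derive_on.
  apply (iota_correct (K := R_AbsRing) (V := R_CompleteNormedModule)).
  exists l. split; auto. intros l' Hl'. eapply is_derive_on_unique; eauto.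
Qed.

Lemma Derive_on_unique a b f x l :
  a < b -> a <= x <= b -> is_derive_on a b f x l -> Derive_on a b f x = l.
Proof.
  intros Hab Hx Hl. apply (is_derive_on_unique a b f x); auto.
  apply Derive_on_correct; auto. now exists l.
Qed.

Lemma is_derive_on_interior a b f x l :
  a < x < b -> is_derive_on a b f x l -> is_derive f x l.
Proof.
  intros Hx [Hlin H]. split. exact Hlin.
  intros x' Hx' eps.
  assert (E : x = x') by now apply is_filter_lim_locally_unique.
  subst x'.
  assert (Hlim : is_filter_lim (within (fun y => a <= y <= b) (locally x)) x).
  { intros Q HQ. unfold within. eapply filter_imp; [|exact HQ]. auto. }
  generalize (filter_and _ _ (locally_open_interval a b x Hx) (H x Hlim eps)).
  apply filter_imp. intros y [Hy1 Hy2]. apply Hy2. lra.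
Qed.

Lemma is_derive_on_scal a b f x l k :
  is_derive_on a b f x l -> is_derive_on a b (fun y => k * f y) x (k * l).
Proof.
  intros H. unfold is_derive_on.
  apply (filterdiff_ext_lin (K := R_AbsRing) (U := R_NormedModule) (V := R_NormedModule)
           (fun y => k * f y) (fun h : R => scal k (scal h l))).
  - apply (filterdiff_scal_r_fct (V := R_NormedModule) k f (fun h => scal h l)); auto.
    intros; apply Rmult_comm.
  - intros h. unfold scal; simpl; unfold mult; simpl. ring.
Qed.

(** The point of [[a, b]] nearest to [x] (for [a <= b]). *)
Definition clamp (a b x : R) : R := Rmax a (Rmin b x).

Lemma clamp_bounds a b x : a <= b -> a <= clamp a b x <= b.
Proof.
  intros Hab. unfold clamp. split. apply Rmax_l.
  apply Rmax_lub; auto. apply Rmin_l.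
Qed.

Lemma clamp_id a b x : a <= x <= b -> clamp a b x = x.
Proof. intros Hx. unfold clamp. rewrite Rmin_right by lra. apply Rmax_right. lra. Qed.

Lemma clamp_idem a b x : a <= b -> clamp a b (clamp a b x) = clamp a b x.
Proof. intros Hab. now apply clamp_id, clamp_bounds. Qed.

Lemma clamp_lipschitz a b x y : Rabs (clamp a b x - clamp a b y) <= Rabs (x - y).
Proof.
  pose proof (Rle_abs (x - y)). pose proof (Rle_abs (- (x - y))) as H'.
  rewrite Rabs_Ropp in H'. apply Rabs_le. unfold clamp, Rmax, Rmin.
  repeat destruct Rle_dec; lra.
Qed.

(** The extension to the plane of a function on the closed sector, constant
    beyond each side of the rectangle [[1, 2] x [0, th0]]. *)
Definition extend (th0 : R) (g : R -> R -> R) (r t : R) : R :=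
  g (clamp 1 2 r) (clamp 0 th0 t).

Lemma extend_eq th0 g r t : Omega_closed 1 2 th0 r t -> extend th0 g r t = g r t.
Proof. intros [Hr Ht]. unfold extend. now rewrite !clamp_id. Qed.

Lemma clamp_closed th0 r t :
  0 < th0 -> Omega_closed 1 2 th0 (clamp 1 2 r) (clamp 0 th0 t).
Proof. intros H. split; apply clamp_bounds; lra. Qed.

Lemma cont2_extend th0 g :
  0 < th0 ->
  continuous_on (fun z : R * R => Omega_closed 1 2 th0 (fst z) (snd z))
    (fun z : R * R => g (fst z) (snd z)) ->
  cont2 (extend th0 g).
Proof.
  intros Hth Hg r t eps.
  destruct (Hg (clamp 1 2 r, clamp 0 th0 t) (clamp_closed th0 r t Hth)
              (ball (extend th0 g r t) eps) (locally_ball _ eps)) as [d Hd].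
  exists d. intros u v Hu Hv. unfold extend at 1.
  apply (Hd (clamp 1 2 u, clamp 0 th0 v)).
  - split; (eapply Rle_lt_trans; [apply clamp_lipschitz|assumption]).
  - now apply clamp_closed.
Qed.

Lemma C1_extend th0 g :
  0 < th0 -> Ck_sector 1 1 2 th0 g ->
  C1_strip th0 (extend th0 g) (extend th0 (partial_r 1 2 g))
     (extend th0 (partial_theta th0 g)).
Proof.
  intros Hth [Hc [Hex [[Hr _] [Ht _]]]].
  split; try (now apply cont2_extend).
  - intros r t Hr0. pose proof (clamp_bounds 0 th0 t ltac:(lra)) as Hct.
    destruct (Hex r (clamp 0 th0 t)) as [He _]. split; lra.
    apply Derive_on_correct, is_derive_on_interior in He; try lra.
    unfold extend at 2. rewrite (clamp_id 1 2 r) by lra.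
    eapply is_derive_ext_loc; [|exact He].
    generalize (locally_open_interval 1 2 r Hr0). apply filter_imp.
    intros s Hs. unfold extend. now rewrite (clamp_id 1 2 s) by lra.
  - intros r t Ht0. pose proof (clamp_bounds 1 2 r ltac:(lra)) as Hcr.
    destruct (Hex (clamp 1 2 r) t) as [_ He]. split; lra.
    apply Derive_on_correct, is_derive_on_interior in He; try lra.
    unfold extend at 2. rewrite (clamp_id 0 th0 t) by lra.
    eapply is_derive_ext_loc; [|exact He].
    generalize (locally_open_interval 0 th0 t Ht0). apply filter_imp.
    intros s Hs. unfold extend. now rewrite (clamp_id 0 th0 s) by lra.
Qed.

Lemma Ck_sector_slice k th0 g r :
  1 <= r <= 2 -> Ck_sector k 1 2 th0 g -> Ck_interval k 0 th0 (g r).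
Proof.
  intros Hr. revert g. induction k as [|k IH]; intros g [Hc Hk].
  all: assert (Hc' : continuous_on (fun x => 0 <= x <= th0) (g r)).
  1, 3: intros t Ht Q HQ;
    destruct (Hc (r, t) (conj Hr Ht) Q HQ) as [d Hd]; exists d; intros s Hs Hs';
    apply (Hd (r, s)); [split; [apply ball_center|exact Hs] | now split].
  - now split.
  - destruct Hk as [Hex [_ Ht]]. split; auto. split.
    + intros t Htt. now apply Hex.
    + exact (IH _ Ht).
Qed.

(** The radius, clamped to [[1, 2]] so that its inverse is continuous everywhere. *)
Definition radius (r _ : R) : R := clamp 1 2 r.

Lemma radius_id r t : 1 <= r <= 2 -> radius r t = r.
Proof. apply clamp_id. Qed.

Lemma radius_neq_0 r t : radius r t <> 0.
Proof. pose proof (clamp_bounds 1 2 r ltac:(lra)). unfold radius. lra. Qed.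

Lemma C1_radius th0 : C1_strip th0 radius (fun _ _ => 1) (fun _ _ => 0).
Proof.
  split; try apply cont2_const.
  - intros r t eps. exists eps. intros u v Hu _.
    eapply Rle_lt_trans; [apply clamp_lipschitz|assumption].
  - intros r t Hr. apply (is_derive_ext_loc (fun s => s)); [|apply @is_derive_id].
    generalize (locally_open_interval 1 2 r Hr). apply filter_imp.
    intros s Hs. symmetry. apply clamp_id. lra.
  - intros. unfold radius. apply @is_derive_const.
Qed.

Lemma FTC_oriented (G g : R -> R) a b :
  (forall x, continuous G x) -> (forall x, continuous g x) ->
  (forall x, Rmin a b < x < Rmax a b -> is_derive G x (g x)) ->
  RInt g a b = G b - G a.
Proof.
  intros HG Hg Hd. destruct (Rtotal_order a b) as [H|[<-|H]].
  - rewrite Rmin_left, Rmax_right in Hd by lra. now apply FTC_open.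
  - rewrite RInt_point. unfold zero; simpl. ring.
  - rewrite Rmin_right, Rmax_left in Hd by lra.
    rewrite <- (opp_RInt_swap g b a).
    + rewrite (FTC_open G g b a) by auto. unfold opp; simpl. ring.
    + apply (@ex_RInt_continuous R_CompleteNormedModule). auto.
Qed.

(** The primitive of [f] in [t] that vanishes on the ray [t = e]; for
    [f = r * u_r] this is the stream function corrected by the circulation
    [c * ln r], see [C1_potential]. *)
Definition potential (th0 e : R) (f : R -> R -> R) (r t : R) : R :=
  RInt (f r) e (clamp 0 th0 t).

(** The radial derivative comes from differentiating under the integral and from
    incompressibility, [r * fr = - vt]. *)
Lemma C1_potential th0 e c f fr ft v vr vt :
  0 <= e <= th0 -> C1_strip th0 f fr ft -> C1_strip th0 v vr vt ->
  (forall r t, v r (clamp 0 th0 t) = v r t) ->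
  (forall r t, 1 < r < 2 -> 0 < t < th0 -> r * fr r t + vt r t = 0) ->
  (forall r, 1 < r < 2 -> v r e = c) ->
  C1_strip th0 (potential th0 e f) (fun r t => (c - v r t) * / radius r t) f.
Proof.
  intros He [Hf Hfr Hft Hdf _] [Hv Hvr Hvt _ Hdv] Hcl Hdiv Hce.
  assert (Hinv : cont2 (fun r t => / radius r t)).
  { apply cont2_inv. apply (C1_radius th0). apply radius_neq_0. }
  split; cont2_tac.
  - intros r t eps. destruct (cont2_RInt f e Hf r (clamp 0 th0 t) eps) as [d Hd].
    exists d. intros s x Hs Hx. apply Hd; auto.
    eapply Rle_lt_trans; [apply clamp_lipschitz|assumption].
  - intros r t Hr. rewrite radius_id by lra.
    pose proof (clamp_bounds 0 th0 t ltac:(lra)) as Hct.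
    replace ((c - v r t) * / r) with (RInt (fr r) e (clamp 0 th0 t)).
    { unfold potential. now apply is_derive_RInt_r. }
    refine (eq_trans (FTC_oriented (fun x => - / r * v r x) (fr r) _ _ _ _ _) _).
    + intros x. apply (continuous_scal_r (V := R_NormedModule) (- / r) (v r)).
      now apply cont2_slice_t.
    + now apply cont2_slice_t.
    + intros x Hx.
      assert (Hx' : 0 < x < th0).
      { unfold Rmin, Rmax in Hx. repeat destruct Rle_dec; lra. }
      replace (fr r x) with (- / r * vt r x).
      * apply is_derive_scal. auto.
      * replace (vt r x) with (- (r * fr r x)) by (specialize (Hdiv r x Hr Hx'); lra).
        field. lra.
    + rewrite Hcl, Hce by auto.
      change (- / r * v r t - - / r * c = (c - v r t) * / r). field. lra.
  - intros r t Ht.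
    apply (is_derive_ext_loc (fun x => RInt (f r) e x)); [|now apply is_derive_RInt_t].
    generalize (locally_open_interval 0 th0 t Ht). apply filter_imp.
    intros s Hs. unfold potential. now rewrite clamp_id by lra.
Qed.

(** Equality of mixed derivatives for a function [H] about which nothing is known
    except that its first derivatives are [A] and [B], of class C1. *)
Lemma mixed_partials th0 (H A Ar At B Br Bt : R -> R -> R) :
  C1_strip th0 A Ar At -> C1_strip th0 B Br Bt ->
  (forall r t, 1 < r < 2 -> 0 < t < th0 -> is_derive (fun s => H s t) r (A r t)) ->
  (forall r t, 1 < r < 2 -> 0 < t < th0 -> is_derive (fun s => H r s) t (B r t)) ->
  forall r t, 1 < r < 2 -> 0 < t < th0 -> At r t = Br r t.
Proof.
  intros [_ _ HcAt _ HdA] [_ HcBr _ HdB _] HA HB r t Hr Ht.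
  assert (DA : forall r t, 1 < r < 2 -> 0 < t < th0 -> Derive (fun s => H s t) r = A r t)
    by (intros; apply is_derive_unique; auto).
  assert (DB : forall r t, 1 < r < 2 -> 0 < t < th0 -> Derive (fun s => H r s) t = B r t)
    by (intros; apply is_derive_unique; auto).
  assert (DAt : forall r t, 1 < r < 2 -> 0 < t < th0 ->
     is_derive (fun z => Derive (fun s => H s z) r) t (At r t)).
  { intros r' t' Hr' Ht'. eapply is_derive_ext_loc; [|now apply HdA].
    generalize (locally_open_interval 0 th0 t' Ht'). apply filter_imp.
    intros z Hz. symmetry. auto. }
  assert (DBr : forall r t, 1 < r < 2 -> 0 < t < th0 ->
     is_derive (fun z => Derive (fun s => H z s) t) r (Br r t)).
  { intros r' t' Hr' Ht'. eapply is_derive_ext_loc; [|now apply HdB].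
    generalize (locally_open_interval 1 2 r' Hr'). apply filter_imp.
    intros z Hz. symmetry. auto. }
  assert (Hloc : locally_2d (fun u w => 1 < u < 2 /\ 0 < w < th0) r t).
  { destruct (locally_open_interval 1 2 r Hr) as [d1 H1].
    destruct (locally_open_interval 0 th0 t Ht) as [d2 H2].
    assert (Hd : 0 < Rmin d1 d2) by (apply Rmin_glb_lt; apply cond_pos).
    exists (mkposreal _ Hd). simpl. intros u w Hu Hw.
    pose proof (Rmin_l d1 d2). pose proof (Rmin_r d1 d2).
    split. apply H1. unfold ball; simpl; unfold AbsRing_ball, abs, minus, plus, opp; simpl.
    unfold Rminus in Hu. lra.
    apply H2. unfold ball; simpl; unfold AbsRing_ball, abs, minus, plus, opp; simpl.
    unfold Rminus in Hw. lra. }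
  rewrite <- (is_derive_unique _ _ _ (DAt r t Hr Ht)),
          <- (is_derive_unique _ _ _ (DBr r t Hr Ht)).
  symmetry. apply (Schwarz H).
  - eapply locally_2d_impl; [|exact Hloc]. apply locally_2d_forall.
    intros u w [Hu Hw]. repeat split.
    + exists (A u w). auto.
    + exists (B u w). auto.
    + exists (Br u w). auto.
    + exists (At u w). auto.
  - apply (continuity_2d_pt_ext_loc Br); [|apply HcBr].
    eapply locally_2d_impl; [|exact Hloc]. apply locally_2d_forall.
    intros u w [Hu Hw]. symmetry. apply is_derive_unique. auto.
  - apply (continuity_2d_pt_ext_loc At); [|apply HcAt].
    eapply locally_2d_impl; [|exact Hloc]. apply locally_2d_forall.
    intros u w [Hu Hw]. symmetry. apply is_derive_unique. auto.
Qed.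

Lemma is_derive_ext_derive (f : R -> R) (x l1 l2 : R) :
  is_derive f x l1 -> l1 = l2 -> is_derive f x l2.
Proof. now intros H <-. Qed.

(** * The Euler equations in polar coordinates *)

Lemma is_derive_comp_2d (U : R -> R -> R) (x y : R -> R) s dx dy :
  differentiable_pt U (x s) (y s) -> is_derive x s dx -> is_derive y s dy ->
  is_derive (fun z => U (x z) (y z)) s
    (Defs.Dx U (x s) (y s) * dx + Defs.Dy U (x s) (y s) * dy).
Proof.
  intros [lx [ly HU]] Hx Hy.
  destruct (differentiable_pt_lim_unique _ _ _ _ _ HU) as [E1 E2].
  unfold Defs.Dx, Defs.Dy. rewrite E1, E2.
  apply is_derive_Reals. apply is_derive_Reals in Hx, Hy.
  now apply derivable_pt_lim_comp_2d.
Qed.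

(** The chain rule along the two coordinate lines gives the pressure gradient and the
    divergence in polar coordinates from pointwise differentiability only. *)
Lemma polar_euler th0 uth ur P r t uth_r uth_t ur_r ur_t :
  euler_solution 1 2 th0 uth ur P -> 1 < r < 2 -> 0 < t < th0 ->
  is_derive (fun s => uth s t) r uth_r -> is_derive (fun s => uth r s) t uth_t ->
  is_derive (fun s => ur s t) r ur_r -> is_derive (fun s => ur r s) t ur_t ->
  is_derive (fun s => P s t) r
    (- (ur r t * ur_r + uth r t / r * ur_t - uth r t ^ 2 / r)) /\
  is_derive (fun s => P r s) t
    (- (r * ur r t * uth_r + uth r t * uth_t + ur r t * uth r t)) /\
  r * ur_r + ur r t + uth_t = 0.
Proof.
  intros [U1 [U2 [Q HE]]] Hr Ht A1 A2 B1 B2.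
  assert (Xr : is_derive (fun s => s * cos t) r (cos t)) by (auto_derive; auto; ring).
  assert (Yr : is_derive (fun s => s * sin t) r (sin t)) by (auto_derive; auto; ring).
  assert (Xt : is_derive (fun s => r * cos s) t (- (r * sin t))) by (auto_derive; auto; ring).
  assert (Yt : is_derive (fun s => r * sin s) t (r * cos t)) by (auto_derive; auto; ring).
  (* These equalities hold on an open set, so they can be differentiated. *)
  assert (Hcomp : forall s z, 1 < s < 2 -> 0 < z < th0 ->
    U1 (s * cos z) (s * sin z) = - uth s z * sin z + ur s z * cos z /\
    U2 (s * cos z) (s * sin z) = uth s z * cos z + ur s z * sin z /\
    Q (s * cos z) (s * sin z) = P s z).
  { intros s z Hs Hz. destruct (HE s z (conj Hs Hz)) as [E1 [E2 _]].
    unfold vfield, e_theta, e_r in E1. injection E1 as E1a E1b.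
    unfold plus, scal in *; simpl in *; unfold mult, plus in *; simpl in *.
    repeat split; lra. }
  destruct (HE r t (conj Hr Ht)) as [_ [_ [[D1 [D2 D3]] [M1 [M2 M3]]]]].
  destruct (Hcomp r t Hr Ht) as [C1' [C2 _]]. rewrite C1', C2 in M1, M2.
  assert (DA1 : Derive (fun s : R => uth s t) r = uth_r) by now apply is_derive_unique.
  assert (DA2 : Derive (fun s : R => uth r s) t = uth_t) by now apply is_derive_unique.
  assert (DB1 : Derive (fun s : R => ur s t) r = ur_r) by now apply is_derive_unique.
  assert (DB2 : Derive (fun s : R => ur r s) t = ur_t) by now apply is_derive_unique.
  assert (Lr := locally_open_interval 1 2 r Hr).
  assert (Lt := locally_open_interval 0 th0 t Ht).
  set (x := r * cos t) in *. set (y := r * sin t) in *.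
  assert (U1r : Defs.Dx U1 x y * cos t + Defs.Dy U1 x y * sin t = - uth_r * sin t + ur_r * cos t).
  { pose proof (is_derive_comp_2d U1 _ _ _ _ _ D1 Xr Yr) as H.
    refine (eq_trans (eq_sym (is_derive_unique _ _ _ H)) _). apply is_derive_unique.
    apply (is_derive_ext_loc (fun s => - uth s t * sin t + ur s t * cos t)).
    { revert Lr. apply filter_imp. intros s Hs. symmetry. now apply Hcomp. }
    auto_derive; [repeat split; eexists; eassumption|].
    rewrite DA1, DB1. ring. }
  assert (U2r : Defs.Dx U2 x y * cos t + Defs.Dy U2 x y * sin t = uth_r * cos t + ur_r * sin t).
  { pose proof (is_derive_comp_2d U2 _ _ _ _ _ D2 Xr Yr) as H.
    refine (eq_trans (eq_sym (is_derive_unique _ _ _ H)) _). apply is_derive_unique.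
    apply (is_derive_ext_loc (fun s => uth s t * cos t + ur s t * sin t)).
    { revert Lr. apply filter_imp. intros s Hs. symmetry. now apply Hcomp. }
    auto_derive; [repeat split; eexists; eassumption|].
    rewrite DA1, DB1. ring. }
  assert (U1t : Defs.Dx U1 x y * - y + Defs.Dy U1 x y * x =
     - uth_t * sin t - uth r t * cos t + ur_t * cos t - ur r t * sin t).
  { pose proof (is_derive_comp_2d U1 _ _ _ _ _ D1 Xt Yt) as H.
    refine (eq_trans (eq_sym (is_derive_unique _ _ _ H)) _). apply is_derive_unique.
    apply (is_derive_ext_loc (fun s => - uth r s * sin s + ur r s * cos s)).
    { revert Lt. apply filter_imp. intros s Hs. symmetry. now apply Hcomp. }
    auto_derive; [repeat split; eexists; eassumption|].
    rewrite DA2, DB2. ring. }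
  assert (U2t : Defs.Dx U2 x y * - y + Defs.Dy U2 x y * x =
     uth_t * cos t - uth r t * sin t + ur_t * sin t + ur r t * cos t).
  { pose proof (is_derive_comp_2d U2 _ _ _ _ _ D2 Xt Yt) as H.
    refine (eq_trans (eq_sym (is_derive_unique _ _ _ H)) _). apply is_derive_unique.
    apply (is_derive_ext_loc (fun s => uth r s * cos s + ur r s * sin s)).
    { revert Lt. apply filter_imp. intros s Hs. symmetry. now apply Hcomp. }
    auto_derive; [repeat split; eexists; eassumption|].
    rewrite DA2, DB2. ring. }
  assert (Pr : is_derive (fun s => P s t) r (Defs.Dx Q x y * cos t + Defs.Dy Q x y * sin t)).
  { eapply is_derive_ext_loc; [|exact (is_derive_comp_2d Q _ _ _ _ _ D3 Xr Yr)].
    revert Lr. apply filter_imp. intros s Hs. now apply Hcomp. }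
  assert (Pt : is_derive (fun s => P r s) t (Defs.Dx Q x y * - y + Defs.Dy Q x y * x)).
  { eapply is_derive_ext_loc; [|exact (is_derive_comp_2d Q _ _ _ _ _ D3 Xt Yt)].
    revert Lt. apply filter_imp. intros s Hs. now apply Hcomp. }
  pose proof (sin2_cos2 t) as SC. unfold Rsqr in SC.
  (* The radial and azimuthal components of the momentum equations, and the
     divergence, in terms of the derivatives along the two coordinate lines. *)
  subst x y. set (x := r * cos t) in *. set (y := r * sin t) in *.
  set (sn := sin t) in *. set (cs := cos t) in *.
  set (a := Defs.Dx U1 x y) in *. set (b := Defs.Dy U1 x y) in *.
  set (p := Defs.Dx U2 x y) in *. set (q := Defs.Dy U2 x y) in *.
  set (th := uth r t) in *. set (rd := ur r t) in *.
  set (qx := Defs.Dx Q x y) in *. set (qy := Defs.Dy Q x y) in *.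
  assert (E1 : qx * cs + qy * sn =
    - (rd * ((a * cs + b * sn) * cs + (p * cs + q * sn) * sn)
       + th / r * ((a * - y + b * x) * cs + (p * - y + q * x) * sn))).
  { replace qx with (- - qx) by ring. rewrite <- M1.
    replace qy with (- - qy) by ring. rewrite <- M2. unfold x, y. fold sn cs. field. lra. }
  assert (E2 : qx * - y + qy * x =
    - (r * (rd * (- (a * cs + b * sn) * sn + (p * cs + q * sn) * cs))
       + th * (- (a * - y + b * x) * sn + (p * - y + q * x) * cs))).
  { replace qx with (- - qx) by ring. rewrite <- M1.
    replace qy with (- - qy) by ring. rewrite <- M2. unfold x, y. fold sn cs. ring. }
  assert (E3 : r * (a + q) * (sn * sn + cs * cs) =
    r * ((a * cs + b * sn) * cs + (p * cs + q * sn) * sn)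
    + (- (a * - y + b * x) * sn + (p * - y + q * x) * cs)).
  { unfold x, y. fold sn cs. ring. }
  rewrite U1r, U2r, U1t, U2t in E1, E2, E3.
  rewrite E1 in Pr. rewrite E2 in Pt. rewrite M3 in E3.
  split; [|split].
  - replace (- (rd * ur_r + th / r * ur_t - th ^ 2 / r)) with
      (- (rd * (ur_r * (sn * sn + cs * cs))
          + th / r * ((ur_t - th) * (sn * sn + cs * cs)))) by (rewrite SC; field; lra).
    eapply is_derive_ext_derive; [exact Pr|]. ring.
  - replace (- (r * rd * uth_r + th * uth_t + rd * th)) with
      (- (r * rd * (uth_r * (sn * sn + cs * cs))
          + th * ((uth_t + rd) * (sn * sn + cs * cs)))) by (rewrite SC; ring).
    eapply is_derive_ext_derive; [exact Pt|]. ring.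
  - replace (r * ur_r + rd + uth_t) with
      (r * (ur_r * (sn * sn + cs * cs)) + (uth_t + rd) * (sn * sn + cs * cs))
      by (rewrite SC; ring).
    transitivity (r * 0 * (sn * sn + cs * cs)); [|ring]. rewrite E3. ring.
Qed.

(** Closed forms of the two derivatives may be replaced pointwise. *)
Lemma C1_strip_eq th0 f fr ft fr' ft' :
  C1_strip th0 f fr ft -> (forall r t, fr r t = fr' r t) ->
  (forall r t, ft r t = ft' r t) -> C1_strip th0 f fr' ft'.
Proof.
  intros [] Hr Ht. split; auto.
  - intros x y. now apply (continuity_2d_pt_ext fr).
  - intros x y. now apply (continuity_2d_pt_ext ft).
  - intros r t H. rewrite <- Hr. auto.
  - intros r t H. rewrite <- Ht. auto.
Qed.

Lemma C1_scal th0 k f fr ft :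
  C1_strip th0 f fr ft ->
  C1_strip th0 (fun r t => k * f r t) (fun r t => k * fr r t) (fun r t => k * ft r t).
Proof.
  intros H. eapply C1_strip_eq; [apply (C1_mult _ _ _ _ _ _ _ (C1_const th0 k) H)| |];
    intros; simpl; ring.
Qed.

Lemma C1_square th0 f fr ft :
  C1_strip th0 f fr ft ->
  C1_strip th0 (fun r t => f r t ^ 2) (fun r t => 2 * f r t * fr r t)
    (fun r t => 2 * f r t * ft r t).
Proof.
  intros H. destruct (C1_mult _ _ _ _ _ _ _ H H) as [K1 K2 K3 K4 K5].
  assert (E : forall x : R, x * x = x ^ 2) by (intros; ring).
  split.
  - intros x y. eapply continuity_2d_pt_ext; [|apply K1]. intros; apply E.
  - intros x y. eapply continuity_2d_pt_ext; [|apply K2]. intros; simpl; ring.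
  - intros x y. eapply continuity_2d_pt_ext; [|apply K3]. intros; simpl; ring.
  - intros r t Hr. eapply is_derive_ext; [intros s; apply E|].
    eapply is_derive_ext_derive; [exact (K4 r t Hr)|]. simpl; ring.
  - intros r t Ht. eapply is_derive_ext; [intros s; apply E|].
    eapply is_derive_ext_derive; [exact (K5 r t Ht)|]. simpl; ring.
Qed.

(** * Vorticity and rigidity *)

Lemma derive_of_zero (h : R -> R) a b x l :
  a < x < b -> (forall y, a < y < b -> h y = 0) -> is_derive h x l -> l = 0.
Proof.
  intros Hx H0 Hl. rewrite <- (is_derive_unique _ _ _ Hl). apply is_derive_unique.
  apply (is_derive_ext_loc (fun _ => 0)); [|apply @is_derive_const].
  generalize (locally_open_interval a b x Hx). apply filter_imp.
  intros y Hy. symmetry. auto.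
Qed.

Lemma zero_closure (h : R -> R) a b :
  a < b -> (forall x, continuous h x) -> (forall x, a < x < b -> h x = 0) ->
  forall x, a <= x <= b -> h x = 0.
Proof.
  intros Hab Hc H0 x Hx. rewrite <- (H0 ((a + b) / 2)) by lra.
  apply (derive_zero_const h a b); auto; try lra.
  intros y Hy. apply (is_derive_ext_loc (fun _ => 0)); [|apply @is_derive_const].
  generalize (locally_open_interval a b y Hy). apply filter_imp.
  intros z Hz. symmetry. auto.
Qed.

Lemma periodic_partial_theta th0 g gr gt :
  C1_strip th0 g gr gt -> (forall t, 0 < t < th0 -> g 1 t = g 2 t) ->
  forall t, 0 < t < th0 -> gt 1 t = gt 2 t.
Proof.
  intros [_ _ _ _ Hd] Hper t Ht. apply Rminus_diag_uniq.
  apply (derive_of_zero (fun s => g 1 s - g 2 s) 0 th0 t); auto.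
  - intros s Hs. rewrite Hper by auto. ring.
  - apply (is_derive_minus (g 1) (g 2)); auto.
Qed.

(** Periodicity of the mass flux through an arc forces equal fluxes through the
    two edges. *)
Lemma edge_fluxes_equal th0 f fr ft v vr vt c1 c2 :
  0 < th0 -> C1_strip th0 f fr ft -> C1_strip th0 v vr vt ->
  (forall r t, 1 < r < 2 -> 0 < t < th0 -> r * fr r t + vt r t = 0) ->
  (forall t, 0 < t < th0 -> f 1 t = f 2 t) ->
  (forall r, 1 < r < 2 -> v r 0 = c1) -> (forall r, 1 < r < 2 -> v r th0 = c2) ->
  c1 = c2.
Proof.
  intros Hth Hf Hv Hdiv Hper H0 H1.
  destruct (periodic_flux th0 _ _ _ _ _ _ Hth
      (C1_scal th0 (c1 - c2) _ _ _ Hf) (C1_scal th0 (c1 - c2) _ _ _ Hv)) as [_ H].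
  - intros t Ht. now rewrite Hper.
  - intros r t Hr Ht.
    replace (_ + _) with ((c1 - c2) * (r * fr r t + vt r t)) by ring.
    rewrite Hdiv by auto. lra.
  - intros r Hr. rewrite H0, H1 by auto. pose proof (pow2_ge_0 (c1 - c2)). nra.
  - specialize (H (3 / 2) ltac:(lra)). rewrite H0, H1 in H by lra.
    assert (E : (c1 - c2) * (c1 - c2) = 0) by lra.
    apply Rmult_integral in E. lra.
Qed.

(** A nonnegative periodic quantity [X] that grows along the flow at the rate
    [k * f] of constant sign is zero, provided that its flux through the edges
    has the sign opposite to the growth.  The multiplier [lam] adjusts signs. *)
Lemma transported_vanishes th0 f fr ft v vr vt X Xr Xt lam k :
  0 < th0 -> C1_strip th0 f fr ft -> C1_strip th0 v vr vt -> C1_strip th0 X Xr Xt ->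
  (forall r t, 1 < r < 2 -> 0 < t < th0 -> r * fr r t + vt r t = 0) ->
  (forall r t, 1 < r < 2 -> 0 < t < th0 ->
     r * f r t * Xr r t + v r t * Xt r t = k * f r t * X r t) ->
  (forall t, 0 < t < th0 -> f 1 t = f 2 t) ->
  (forall t, 0 < t < th0 -> X 1 t = X 2 t) ->
  (forall r t, 0 <= X r t) ->
  (forall r t, 0 < lam * k * f r t) ->
  (forall r, 1 < r < 2 -> lam * (v r th0 * X r th0) <= lam * (v r 0 * X r 0)) ->
  forall r t, 1 < r < 2 -> 0 < t < th0 -> X r t = 0.
Proof.
  intros Hth Hf Hv HX Hdiv Htr Pf PX HX0 Hlam Hedge.
  assert (E : forall r t, 1 < r < 2 -> 0 < t < th0 ->
    r * (lam * (fr r t * X r t + f r t * Xr r t))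
      + lam * (vt r t * X r t + v r t * Xt r t) = lam * k * f r t * X r t).
  { intros r t Hr Ht.
    replace (_ + _) with
      (lam * ((r * fr r t + vt r t) * X r t + (r * f r t * Xr r t + v r t * Xt r t)))
      by ring.
    rewrite Hdiv, Htr by auto. ring. }
  destruct (periodic_flux th0 _ _ _ _ _ _ Hth
    (C1_scal th0 lam _ _ _ (C1_mult _ _ _ _ _ _ _ Hf HX))
    (C1_scal th0 lam _ _ _ (C1_mult _ _ _ _ _ _ _ Hv HX))) as [H _].
  - intros t Ht. now rewrite Pf, PX.
  - intros r t Hr Ht. rewrite E by auto. apply Rmult_le_pos; auto. now left.
  - auto.
  - intros r t Hr Ht. specialize (H r t Hr Ht). rewrite E in H by auto.
    specialize (Hlam r t). apply Rmult_integral in H. lra.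
Qed.

(** With [f = r * u_r] and [v = r * u_theta], the vorticity is [W / r ^ 2], and its
    conservation along the flow reads [(r f d_r + v d_t) W = 2 f W]. *)
Lemma vorticity_transport th0 P f fr ft v vr vt W Wr Wt :
  C1_strip th0 f fr ft -> C1_strip th0 v vr vt -> C1_strip th0 W Wr Wt ->
  (forall r t, 1 < r < 2 -> W r t = r * vr r t - ft r t) ->
  (forall r t, 1 < r < 2 -> 0 < t < th0 -> r * fr r t + vt r t = 0) ->
  (forall r t, 1 < r < 2 -> 0 < t < th0 -> is_derive (fun s => P s t) r
     (- (f r t * fr r t / r ^ 2 + v r t * ft r t / r ^ 3
         - (f r t ^ 2 + v r t ^ 2) / r ^ 3))) ->
  (forall r t, 1 < r < 2 -> 0 < t < th0 -> is_derive (fun s => P r s) t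
     (- (f r t * vr r t / r + v r t * vt r t / r ^ 2))) ->
  forall r t, 1 < r < 2 -> 0 < t < th0 ->
    r * f r t * Wr r t + v r t * Wt r t = 2 * f r t * W r t.
Proof.
  intros Hf Hv HW EW Hdiv HPr HPt r t Hr Ht.
  assert (Hi := C1_inv th0 _ _ _ (C1_radius th0) radius_neq_0).
  (* [H] is the total head: by the Euler equations its gradient is the velocity,
     rotated by a right angle, times the vorticity.  The claim is the equality
     of its mixed derivatives. *)
  set (H := fun r t => P r t + (f r t ^ 2 + v r t ^ 2) / (2 * r ^ 2)).
  assert (HA := C1_mult _ _ _ _ _ _ _ (C1_mult _ _ _ _ _ _ _ Hv HW)
     (C1_mult _ _ _ _ _ _ _ Hi (C1_mult _ _ _ _ _ _ _ Hi Hi))).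
  assert (HB := C1_opp _ _ _ _ (C1_mult _ _ _ _ _ _ _ (C1_mult _ _ _ _ _ _ _ Hf HW)
     (C1_mult _ _ _ _ _ _ _ Hi Hi))).
  pose proof (mixed_partials th0 H _ _ _ _ _ _ HA HB) as M.
  assert (K : forall r t, 1 < r < 2 -> radius r t = r) by (intros; apply radius_id; lra).
  destruct Hf as [_ _ _ Dfr Dft]. destruct Hv as [_ _ _ Dvr Dvt].
  simpl in M.
  match type of M with ?A -> ?B -> _ =>
    assert (HdA : A); [|assert (HdB : B); [|specialize (M HdA HdB r t Hr Ht)]] end.
  - intros r' t' Hr' Ht'. rewrite !K by auto. unfold H.
    pose proof (Hdiv r' t' Hr' Ht') as Hd.
    assert (DA1 : Derive (fun s : R => f s t') r' = fr r' t') by (apply is_derive_unique; auto).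
    assert (DB1 : Derive (fun s : R => v s t') r' = vr r' t') by (apply is_derive_unique; auto).
    assert (DP := HPr r' t' Hr' Ht').
    eapply is_derive_ext_derive.
    + apply (is_derive_plus (fun s => P s t')); [exact DP|].
      auto_derive; [|reflexivity].
      split; [exists (fr r' t'); auto|split; [exists (vr r' t'); auto|split; auto]].
      nra.
    + simpl. unfold plus; simpl.
      rewrite DA1, DB1, EW by auto. field. lra.
  - intros r' t' Hr' Ht'. rewrite !K by auto. unfold H.
    pose proof (Hdiv r' t' Hr' Ht') as Hd.
    assert (DA1 : Derive (fun s : R => f r' s) t' = ft r' t') by (apply is_derive_unique; auto).
    assert (DB1 : Derive (fun s : R => v r' s) t' = vt r' t') by (apply is_derive_unique; auto).
    assert (DP := HPt r' t' Hr' Ht').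
    assert (Evt : vt r' t' = - (r' * fr r' t')) by lra.
    eapply is_derive_ext_derive.
    + apply (is_derive_plus (fun s => P r' s)); [exact DP|].
      auto_derive; [|reflexivity].
      split; [exists (ft r' t'); auto|split; [exists (vt r' t'); auto|auto]].
    + simpl. unfold plus; simpl.
      rewrite DA1, DB1, EW, Evt by auto. field. lra.
  - rewrite !K in M by auto.
    apply Rmult_eq_reg_l with (/ r ^ 3).
    2: { apply Rinv_neq_0_compat, pow_nonzero. lra. }
    pose proof (Hdiv r t Hr Ht) as Hd.
    assert (Evt : vt r t = - (r * fr r t)) by lra.
    rewrite Evt in M.
    apply Rminus_diag_eq in M.
    apply Rminus_diag_uniq. rewrite <- M. field. lra.
Qed.

(** Without flux through the edges, the growth of [W ^ 2] along the flow
    contradicts periodicity unless the flow is irrotational. *)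
Lemma vorticity_zero th0 f fr ft v vr vt W Wr Wt sg :
  0 < th0 -> C1_strip th0 f fr ft -> C1_strip th0 v vr vt -> C1_strip th0 W Wr Wt ->
  (forall r t, 0 < sg * f r t) ->
  (forall r t, 1 < r < 2 -> 0 < t < th0 -> r * fr r t + vt r t = 0) ->
  (forall r t, 1 < r < 2 -> 0 < t < th0 ->
     r * f r t * Wr r t + v r t * Wt r t = 2 * f r t * W r t) ->
  (forall t, 0 < t < th0 -> f 1 t = f 2 t) ->
  (forall t, 0 < t < th0 -> W 1 t = W 2 t) ->
  (forall r, 1 < r < 2 -> v r 0 = 0) -> (forall r, 1 < r < 2 -> v r th0 = 0) ->
  forall r t, 1 < r < 2 -> 0 < t < th0 -> W r t = 0.
Proof.
  intros Hth Hf Hv HW Hsg Hdiv Htr Pf PW H0 H1 r t Hr Ht.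
  assert (E : W r t ^ 2 = 0).
  { apply (transported_vanishes th0 f fr ft v vr vt _ _ _ sg 4 Hth Hf Hv
             (C1_square _ _ _ _ HW)); auto.
    - intros r' t' Hr' Ht'. specialize (Htr r' t' Hr' Ht').
      replace (_ + _) with
        (2 * W r' t' * (r' * f r' t' * Wr r' t' + v r' t' * Wt r' t')) by ring.
      rewrite Htr. ring.
    - intros t' Ht'. now rewrite PW.
    - intros. apply pow2_ge_0.
    - intros r' t'. specialize (Hsg r' t'). lra.
    - intros r' Hr'. rewrite H0, H1 by auto. lra. }
  nra.
Qed.

(** When [c <> 0] and the vorticity is that of a homogeneous flow on one edge
    [t = e], it is a function of the stream function: with [phi] the potential
    based at [e], [Z = W * exp (- 2 phi / c) + A] is constant along the flow and
    zero on that edge.  The weighted square [exp (k phi / c) * Z ^ 2] then grows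
    at a rate whose sign is chosen through [k] according to the edge, so that
    [Z = 0]; differentiating in [t] gives the conclusion. *)
Lemma vorticity_profile th0 f fr ft v vr vt W Wr Wt sg c A e :
  0 < th0 -> C1_strip th0 f fr ft -> C1_strip th0 v vr vt -> C1_strip th0 W Wr Wt ->
  (forall r t, 0 < sg * f r t) ->
  (forall r t, v r (clamp 0 th0 t) = v r t) ->
  (forall r t, 1 < r < 2 -> 0 < t < th0 -> r * fr r t + vt r t = 0) ->
  (forall r t, 1 < r < 2 -> 0 < t < th0 ->
     r * f r t * Wr r t + v r t * Wt r t = 2 * f r t * W r t) ->
  (forall t, 0 < t < th0 -> f 1 t = f 2 t) ->
  (forall t, 0 < t < th0 -> W 1 t = W 2 t) ->
  (forall r, 1 < r < 2 -> v r 0 = c) -> (forall r, 1 < r < 2 -> v r th0 = c) ->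
  c <> 0 -> (e = 0 \/ e = th0) ->
  (forall r, 1 < r < 2 -> W r e = - A) ->
  forall r t, 1 < r < 2 -> 0 < t < th0 -> c * Wt r t = 2 * f r t * W r t.
Proof.
  intros Hth Hf Hv HW Hsg Hcl Hdiv Htr Pf PW H0 H1 Hc He HA.
  assert (He' : 0 <= e <= th0) by lra.
  assert (Hve : forall r, 1 < r < 2 -> v r e = c) by (destruct He; subst e; auto).
  assert (Hphi := C1_potential th0 e c f fr ft v vr vt He' Hf Hv Hcl Hdiv Hve).
  set (phi := potential th0 e f) in *.
  assert (phi_e : forall r, phi r e = 0).
  { intros r. unfold phi, potential. rewrite clamp_id by lra. now rewrite RInt_point. }
  assert (Pphi : forall t, phi 1 t = phi 2 t).
  { intros t. unfold phi, potential. apply RInt_ext. intros x Hx. apply Pf.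
    pose proof (clamp_bounds 0 th0 t ltac:(lra)) as Hct.
    unfold Rmin, Rmax in Hx. repeat destruct Rle_dec; lra. }
  assert (HZ := C1_plus _ _ _ _ _ _ _
    (C1_mult _ _ _ _ _ _ _ HW (C1_exp _ _ _ _ (C1_scal th0 (- (2 / c)) _ _ _ Hphi)))
    (C1_const th0 A)).
  set (Z := fun r t => W r t * exp (- (2 / c) * phi r t) + A) in *.
  simpl in HZ.
  (* The sign [ep] tells the edge: the flux through the other edge enters the
     balance with the sign [- ep]. *)
  assert (eps : exists ep, (ep = 1 /\ e = th0) \/ (ep = -1 /\ e = 0)).
  { destruct He; [exists (-1)|exists 1]; auto. }
  destruct eps as [ep Hep].
  assert (Hep2 : ep * ep = 1) by (destruct Hep as [[-> _]|[-> _]]; ring).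
  assert (HX := C1_mult _ _ _ _ _ _ _
    (C1_exp _ _ _ _ (C1_scal th0 (ep * sg) _ _ _ Hphi)) (C1_square _ _ _ _ HZ)).
  assert (Ze : forall r, 1 < r < 2 -> Z r e = 0).
  { intros r Hr. unfold Z. rewrite phi_e, HA by auto.
    rewrite Rmult_0_r, exp_0. ring. }
  assert (HZ0 : forall r t, 1 < r < 2 -> 0 < t < th0 -> Z r t = 0).
  { intros r t Hr Ht.
    assert (E : exp (ep * sg * phi r t) * Z r t ^ 2 = 0).
    { apply (transported_vanishes th0 f fr ft v vr vt _ _ _ (ep * c) (ep * sg * c)
         Hth Hf Hv HX); auto; clear r t Hr Ht.
      - intros r t Hr Ht. rewrite (radius_id r t) by lra.
        specialize (Htr r t Hr Ht).
        set (E1 := exp (ep * sg * phi r t)). fold (Z r t).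
        set (E2 := exp (- (2 / c) * phi r t)).
        transitivity (ep * sg * c * f r t * (E1 * Z r t ^ 2) +
          2 * E1 * Z r t * E2 * ((r * f r t * Wr r t + v r t * Wt r t) - 2 * f r t * W r t));
          [|rewrite Htr; ring].
        field. split; lra.
      - intros t Ht. unfold Z. now rewrite Pphi, PW.
      - intros r t. apply Rmult_le_pos; [left; apply exp_pos | apply pow2_ge_0].
      - intros r t.
        replace (ep * c * (ep * sg * c) * f r t) with ((ep * ep) * (c * c) * (sg * f r t)) by ring.
        rewrite Hep2, Rmult_1_l. apply Rmult_lt_0_compat; auto. nra.
      - intros r Hr. rewrite H0, H1 by auto.
        destruct Hep as [[-> ->]|[-> ->]]; rewrite Ze by auto.
        + assert (0 <= exp (1 * sg * phi r 0) * Z r 0 ^ 2)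
            by (apply Rmult_le_pos; [left; apply exp_pos | apply pow2_ge_0]).
          assert (0 <= c * c * (exp (1 * sg * phi r 0) * Z r 0 ^ 2))
            by (apply Rmult_le_pos; auto; nra).
          lra.
        + assert (0 <= exp (-1 * sg * phi r th0) * Z r th0 ^ 2)
            by (apply Rmult_le_pos; [left; apply exp_pos | apply pow2_ge_0]).
          assert (0 <= c * c * (exp (-1 * sg * phi r th0) * Z r th0 ^ 2))
            by (apply Rmult_le_pos; auto; nra).
          lra. }
    apply Rmult_integral in E. pose proof (exp_pos (ep * sg * phi r t)). nra. }
  intros r t Hr Ht.
  assert (E := derive_of_zero (Z r) 0 th0 t _ Ht (fun y Hy => HZ0 r y Hr Hy)
                 (C1_der_t _ _ _ _ HZ r t Ht)).
  simpl in E. set (E2 := exp (- (2 / c) * phi r t)) in *.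
  assert (0 < E2) by apply exp_pos.
  apply Rmult_eq_reg_r with (E2 / c).
  2: { apply Rmult_integral_contrapositive_currified; [lra|].
       now apply Rinv_neq_0_compat. }
  apply Rminus_diag_uniq. rewrite <- E. field. auto.
Qed.

(** The angular defect [g = c - v] and [f] satisfy [f Lap g = g Lap f], where [Lap]
    is the Laplacian in [(ln r, t)]; this is the assumption on [vrr], [vrt],
    [ftr], [ftt], once incompressibility is used.  As [f] has no zero, the flux
    lemma applied to [(g / f) * (f grad g - g grad f)], of divergence
    [f ^ 2 * |grad (g / f)| ^ 2], shows that [g / f] is constant; it is zero on
    the edges. *)
Lemma angular_rigidity th0 f fr ft ftr ftt v vr vt vrr vrt vtr vtt c :
  0 < th0 -> C1_strip th0 f fr ft -> C1_strip th0 v vr vt ->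
  C1_strip th0 ft ftr ftt -> C1_strip th0 vr vrr vrt -> C1_strip th0 vt vtr vtt ->
  (forall r t, f r t <> 0) ->
  (forall r t, 1 < r < 2 -> 0 < t < th0 -> r * fr r t + vt r t = 0) ->
  (forall r t, 1 < r < 2 -> 0 < t < th0 -> r * ftr r t + vtt r t = 0) ->
  (forall r t, 1 < r < 2 -> 0 < t < th0 -> vrt r t = vtr r t) ->
  (forall r t, 1 < r < 2 -> 0 < t < th0 ->
     r * f r t * (vr r t + r * vrr r t - ftr r t) =
     (c - v r t) * (r * vrt r t - ftt r t)) ->
  (forall t, 0 < t < th0 -> f 1 t = f 2 t) ->
  (forall t, 0 < t < th0 -> v 1 t = v 2 t) ->
  (forall t, 0 < t < th0 -> vr 1 t = 2 * vr 2 t) ->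
  (forall r, v r 0 = c) -> (forall r, v r th0 = c) ->
  forall r t, 1 <= r <= 2 -> 0 <= t <= th0 -> v r t = c.
Proof.
  intros Hth Hf Hv Hft Hvr Hvt Hf0 Hdiv Hdivt Hmix Hvort Pf Pv Pvr H0 H1.
  assert (Pvt := periodic_partial_theta _ _ _ _ Hv Pv).
  assert (Hg := C1_minus _ _ _ _ _ _ _ (C1_const th0 c) Hv).
  assert (Hs := C1_mult _ _ _ _ _ _ _ Hg (C1_inv _ _ _ _ Hf Hf0)).
  assert (HN1 := C1_minus _ _ _ _ _ _ _
    (C1_mult _ _ _ _ _ _ _ Hg Hvt)
    (C1_mult _ _ _ _ _ _ _ Hf (C1_mult _ _ _ _ _ _ _ (C1_radius th0) Hvr))).
  assert (HN2 := C1_opp _ _ _ _ (C1_plus _ _ _ _ _ _ _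
    (C1_mult _ _ _ _ _ _ _ Hf Hvt) (C1_mult _ _ _ _ _ _ _ Hg Hft))).
  (* [(N1, N2)] is [f grad g - g grad f], where [r * fr] has been replaced by [- vt]
     so that no second radial derivative of [f] is needed. *)
  set (N1 := fun r t => (c - v r t) * vt r t - f r t * (r * vr r t)).
  set (N2 := fun r t => - (f r t * vt r t + (c - v r t) * ft r t)).
  assert (HF := C1_mult _ _ _ _ _ _ _ Hs HN1).
  assert (HG := C1_mult _ _ _ _ _ _ _ Hs HN2).
  assert (E : forall r t, 1 < r < 2 -> 0 < t < th0 ->
    r * (((0 - vr r t) * / f r t + (c - v r t) * (- fr r t * (/ f r t * / f r t))) * N1 r t
         + (c - v r t) * / f r t *
           ((0 - vr r t) * vt r t + (c - v r t) * vtr r t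
            - (fr r t * (r * vr r t) + f r t * (1 * vr r t + r * vrr r t))))
    + (((0 - vt r t) * / f r t + (c - v r t) * (- ft r t * (/ f r t * / f r t))) * N2 r t
         + (c - v r t) * / f r t *
           - (ft r t * vt r t + f r t * vtt r t + ((0 - vt r t) * ft r t + (c - v r t) * ftt r t)))
    = (N1 r t ^ 2 + N2 r t ^ 2) / f r t ^ 2).
  { intros r t Hr Ht. specialize (Hvort r t Hr Ht). specialize (Hf0 r t).
    specialize (Hdiv r t Hr Ht). specialize (Hdivt r t Hr Ht).
    rewrite (Hmix r t Hr Ht) in Hvort.
    assert (Efr : fr r t = - vt r t / r) by (field_simplify_eq; lra).
    assert (Evtt : vtt r t = - r * ftr r t) by lra.
    assert (Evrr : vrr r t = ((c - v r t) * (r * vtr r t - ftt r t) / (r * f r t)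
                              - vr r t + ftr r t) / r).
    { rewrite <- Hvort. field. lra. }
    unfold N1, N2. rewrite Efr, Evtt, Evrr. field. lra. }
  destruct (periodic_flux th0 _ _ _ _ _ _ Hth HF HG) as [HS _].
  - intros t Ht. simpl. rewrite (radius_id 1 t), (radius_id 2 t) by lra.
    rewrite Pf, Pv, Pvt, Pvr by auto. ring.
  - intros r t Hr Ht. simpl. rewrite (radius_id r t) by lra. fold (N1 r t). fold (N2 r t).
    rewrite E by auto. apply Rle_div_r. specialize (Hf0 r t). nra.
    pose proof (pow2_ge_0 (N1 r t)). pose proof (pow2_ge_0 (N2 r t)). lra.
  - intros r Hr. simpl. rewrite H0, H1. lra.
  - assert (HN : forall r t, 1 < r < 2 -> 0 < t < th0 -> N1 r t = 0 /\ N2 r t = 0).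
    { intros r t Hr Ht. specialize (HS r t Hr Ht). simpl in HS.
      rewrite (radius_id r t) in HS by lra. fold (N1 r t) in HS. fold (N2 r t) in HS.
      rewrite E in HS by auto. specialize (Hf0 r t).
      assert (Hsum : N1 r t ^ 2 + N2 r t ^ 2 = 0).
      { replace (_ + _) with ((N1 r t ^ 2 + N2 r t ^ 2) / f r t ^ 2 * f r t ^ 2)
          by (field; auto). rewrite HS. ring. }
      pose proof (pow2_ge_0 (N1 r t)). pose proof (pow2_ge_0 (N2 r t)). split; nra. }
    (* The quotient [s = g / f] has zero angular derivative and vanishes on an edge. *)
    set (s := fun r t => (c - v r t) * / f r t) in *.
    assert (Hs0 : forall r t, 1 < r < 2 -> 0 <= t <= th0 -> s r t = 0).
    { intros r t Hr Ht. transitivity (s r 0).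
      - apply (derive_zero_const (s r) 0 th0); try lra.
        + intros x. apply cont2_slice_t. apply Hs.
        + intros x Hx. eapply is_derive_ext_derive; [exact (C1_der_t _ _ _ _ Hs r x Hx)|].
          simpl. transitivity (N2 r x / f r x ^ 2); [unfold N2; field; auto|].
          rewrite (proj2 (HN r x Hr Hx)). unfold Rdiv. ring.
      - unfold s. rewrite H0. ring. }
    intros r t Hr Ht.
    assert (Hsc : s r t = 0).
    { apply (zero_closure (fun r => s r t) 1 2); auto; try lra.
      intros x. apply (cont2_slice_r s t). apply Hs. }
    unfold s in Hsc. apply Rmult_integral in Hsc.
    destruct Hsc as [Hsc|Hsc]; [lra|]. now apply Rinv_neq_0_compat in Hsc.
Qed.

(** * The flow is homogeneous *)

Lemma nonvanishing_same_sign (h : R -> R) x y :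
  (forall z, continuous h z) -> (forall z, h z <> 0) -> 0 < h x * h y.
Proof.
  intros Hc H0.
  assert (Hle : forall x y, x <= y -> 0 < h x * h y).
  { intros a b Hab. apply Rnot_le_lt. intros Hneg.
    destruct (IVT_cor h a b) as [z [_ Hz]]; auto.
    - intros z. apply continuity_pt_filterlim. apply Hc.
    - exact (H0 z Hz). }
  destruct (Rle_dec x y); auto. rewrite Rmult_comm. apply Hle. lra.
Qed.

Lemma nonvanishing_same_sign_2d f r t :
  cont2 f -> (forall r t, f r t <> 0) -> 0 < f 0 0 * f r t.
Proof.
  intros Hf H0.
  assert (H1 := nonvanishing_same_sign (fun s => f s 0) 0 r
    (cont2_slice_r f 0 Hf) (fun z => H0 z 0)).
  assert (H2 := nonvanishing_same_sign (f r) 0 t (cont2_slice_t f r Hf) (H0 r)).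
  simpl in H1. pose proof (H0 r 0).
  apply Rmult_lt_reg_l with (f r 0 * f r 0); nra.
Qed.

Lemma Ck_sector_pred k a b th0 g : Ck_sector (S k) a b th0 g -> Ck_sector k a b th0 g.
Proof.
  revert g. induction k as [|k IH]; intros g [Hc [Hex [Hr Ht]]].
  - now split.
  - exact (conj Hc (conj Hex (conj (IH _ Hr) (IH _ Ht)))).
Qed.

Lemma euler_extend th0 uth ur P :
  euler_solution 1 2 th0 uth ur P ->
  euler_solution 1 2 th0 (extend th0 uth) (extend th0 ur) P.
Proof.
  intros [U1 [U2 [Q H]]]. exists U1, U2, Q. intros r t Hrt.
  destruct (H r t Hrt) as [E1 E2]. split; auto. rewrite E1.
  destruct Hrt. unfold vfield. rewrite !extend_eq; auto; split; lra.
Qed.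

Lemma C1_radius_mult th0 u ur ut :
  C1_strip th0 u ur ut ->
  C1_strip th0 (fun r t => radius r t * u r t)
    (fun r t => u r t + radius r t * ur r t) (fun r t => radius r t * ut r t).
Proof.
  intros H. eapply C1_strip_eq; [apply (C1_mult _ _ _ _ _ _ _ (C1_radius th0) H)| |];
    intros; simpl; ring.
Qed.

(** The edge condition on [r * u_r] in terms of the angular derivative of the other
    factor, one-sided on the edge. *)
Lemma edge_derivative th0 g r e A :
  0 < th0 -> Ck_sector 1 1 2 th0 g -> 1 <= r <= 2 -> 0 <= e <= th0 ->
  partial_theta th0 (fun s t => s * g s t) r e = A ->
  r * extend th0 (partial_theta th0 g) r e = A.
Proof.
  intros Hth [_ [Hex _]] Hr He <-.
  rewrite extend_eq by (split; auto). unfold partial_theta. symmetry.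
  apply Derive_on_unique; auto. apply is_derive_on_scal.
  apply Derive_on_correct; auto. now apply Hex.
Qed.

(** Under the assumptions of the theorem the azimuthal velocity is [c1 / r].
    The fields are first replaced by their extensions to the plane, after which
    only the facts collected at the beginning are used. *)
Lemma azimuthal_velocity_profile :
  forall (theta0 : R) (u_theta u_r P : R -> R -> R) (c1 c2 : R),
  0 < theta0 ->
  Ck_sector 2 1 2 theta0 u_theta ->
  Ck_sector 2 1 2 theta0 u_r ->
  euler_solution 1 2 theta0 u_theta u_r P ->
  (forall r theta, Omega_closed 1 2 theta0 r theta -> u_r r theta <> 0) ->
  (forall r, 1 <= r <= 2 -> u_theta r 0 = c1 / r) ->
  (forall r, 1 <= r <= 2 -> u_theta r theta0 = c2 / r) ->
  (forall theta, 0 <= theta <= theta0 ->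
     u_r 1 theta = 2 * u_r 2 theta /\
     u_theta 1 theta = 2 * u_theta 2 theta /\
     partial_r 1 2 u_theta 1 theta = 4 * partial_r 1 2 u_theta 2 theta) ->
  c1 = c2 /\
  (c1 = 0 \/
   (exists A : R,
        (forall r, 1 <= r <= 2 ->
           partial_theta theta0 (fun s t => s * u_r s t) r 0 = A) \/
        (forall r, 1 <= r <= 2 ->
           partial_theta theta0 (fun s t => s * u_r s t) r theta0 = A)) ->
   forall r theta, Omega_closed 1 2 theta0 r theta -> u_theta r theta = c1 / r).
Proof.
  intros th0 uth urd P c1 c2 Hth Kth Kr HE Hne Hc1 Hc2 Hper.
  assert (Kth1 := Ck_sector_pred 1 _ _ _ _ Kth).
  assert (Kr1 := Ck_sector_pred 1 _ _ _ _ Kr).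
  assert (Hu := C1_extend th0 urd Hth Kr1).
  assert (Hut := C1_extend th0 _ Hth (proj2 (proj2 (proj2 Kr)))).
  assert (Hw := C1_extend th0 uth Hth Kth1).
  assert (Hwr := C1_extend th0 _ Hth (proj1 (proj2 (proj2 Kth)))).
  assert (Hwt := C1_extend th0 _ Hth (proj2 (proj2 (proj2 Kth)))).
  assert (Heul := fun r t Hr Ht => polar_euler th0 _ _ P r t _ _ _ _
     (euler_extend _ _ _ _ HE) Hr Ht
     (C1_der_r _ _ _ _ Hw r t Hr) (C1_der_t _ _ _ _ Hw r t Ht)
     (C1_der_r _ _ _ _ Hu r t Hr) (C1_der_t _ _ _ _ Hu r t Ht)).
  assert (Hu0 : forall r t, extend th0 urd r t <> 0).
  { intros r t. apply Hne. now apply clamp_closed. }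
  assert (Hw0 : forall r, extend th0 uth r 0 = c1 / clamp 1 2 r).
  { intros r. unfold extend. rewrite (clamp_id 0) by lra. apply Hc1, clamp_bounds. lra. }
  assert (Hw1 : forall r, extend th0 uth r th0 = c2 / clamp 1 2 r).
  { intros r. unfold extend. rewrite (clamp_id 0) by lra. apply Hc2, clamp_bounds. lra. }
  assert (Pu : forall t, extend th0 urd 1 t = 2 * extend th0 urd 2 t).
  { intros t. unfold extend. rewrite !(clamp_id 1 2) by lra.
    apply Hper, clamp_bounds. lra. }
  assert (Pw : forall t, extend th0 uth 1 t = 2 * extend th0 uth 2 t).
  { intros t. unfold extend. rewrite !(clamp_id 1 2) by lra.
    apply Hper, clamp_bounds. lra. }
  assert (Pwr : forall t, extend th0 (partial_r 1 2 uth) 1 t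
                          = 4 * extend th0 (partial_r 1 2 uth) 2 t).
  { intros t. unfold extend. rewrite !(clamp_id 1 2) by lra.
    apply Hper, clamp_bounds. lra. }
  assert (Hwc : forall r t, extend th0 uth r (clamp 0 th0 t) = extend th0 uth r t).
  { intros r t. unfold extend. rewrite clamp_idem; lra. }
  assert (Hedge : forall e A, 0 <= e <= th0 ->
     (forall r, 1 <= r <= 2 -> partial_theta th0 (fun s t => s * urd s t) r e = A) ->
     forall r, 1 < r < 2 -> r * extend th0 (partial_theta th0 urd) r e = A).
  { intros e A He HA r Hr. apply edge_derivative; auto; try apply HA; lra. }
  assert (Huth : forall r t, Omega_closed 1 2 th0 r t -> uth r t = extend th0 uth r t).
  { intros r t Hrt. symmetry. now apply extend_eq. }
  revert Heul Hu Hut Hw Hwr Hwt Hu0 Hw0 Hw1 Pu Pw Pwr Hwc Hedge Huth.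
  generalize (extend th0 urd) (extend th0 (partial_r 1 2 urd))
    (extend th0 (partial_theta th0 urd))
    (extend th0 (partial_r 1 2 (partial_theta th0 urd)))
    (extend th0 (partial_theta th0 (partial_theta th0 urd)))
    (extend th0 uth) (extend th0 (partial_r 1 2 uth))
    (extend th0 (partial_theta th0 uth))
    (extend th0 (partial_r 1 2 (partial_r 1 2 uth)))
    (extend th0 (partial_theta th0 (partial_r 1 2 uth)))
    (extend th0 (partial_r 1 2 (partial_theta th0 uth)))
    (extend th0 (partial_theta th0 (partial_theta th0 uth))).
  intros u ur ut utr utt w wr wt wrr wrt wtr wtt
    Heul Hu Hut Hw Hwr Hwt Hu0 Hw0 Hw1 Pu Pw Pwr Hwc Hedge Huth.
  clear Kth Kr Kth1 Kr1 HE Hne Hc1 Hc2 Hper.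
  assert (Hf := C1_radius_mult _ _ _ _ Hu).
  assert (Hft := C1_radius_mult _ _ _ _ Hut).
  assert (Hv := C1_radius_mult _ _ _ _ Hw).
  assert (Hvr := C1_plus _ _ _ _ _ _ _ Hw (C1_radius_mult _ _ _ _ Hwr)).
  assert (Hvt := C1_radius_mult _ _ _ _ Hwt).
  set (f := fun r t => radius r t * u r t) in *.
  set (fr := fun r t => u r t + radius r t * ur r t) in *.
  set (ft := fun r t => radius r t * ut r t) in *.
  set (ftr := fun r t => ut r t + radius r t * utr r t) in *.
  set (ftt := fun r t => radius r t * utt r t) in *.
  set (v := fun r t => radius r t * w r t) in *.
  set (vr := fun r t => w r t + radius r t * wr r t) in *.
  set (vt := fun r t => radius r t * wt r t) in *.
  set (vrr := fun r t => wr r t + (wr r t + radius r t * wrr r t)) in *.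
  set (vrt := fun r t => wt r t + radius r t * wrt r t) in *.
  set (vtr := fun r t => wt r t + radius r t * wtr r t) in *.
  set (vtt := fun r t => radius r t * wtt r t) in *.
  assert (HW := C1_minus _ _ _ _ _ _ _ (C1_radius_mult _ _ _ _ Hvr) Hft).
  set (W := fun r t => radius r t * vr r t - ft r t) in *.
  set (Wr := fun r t => vr r t + radius r t * vrr r t - ftr r t) in *.
  set (Wt := fun r t => radius r t * vrt r t - ftt r t) in *.
  assert (K : forall r t, 1 < r < 2 -> radius r t = r) by (intros; apply radius_id; lra).
  assert (K1 : forall t, radius 1 t = 1) by (intros; apply radius_id; lra).
  assert (K2 : forall t, radius 2 t = 2) by (intros; apply radius_id; lra).
  assert (Kpos : forall r t, 0 < radius r t).
  { intros. pose proof (clamp_bounds 1 2 r ltac:(lra)). unfold radius. lra. }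
  assert (Hf0 : forall r t, f r t <> 0).
  { intros r t. apply Rmult_integral_contrapositive_currified; auto.
    apply radius_neq_0. }
  assert (Hsg : forall r t, 0 < f 0 0 * f r t).
  { intros. apply nonvanishing_same_sign_2d; auto. apply Hf. }
  assert (Hv0 : forall r, v r 0 = c1).
  { intros r. unfold v. rewrite Hw0. specialize (Kpos r 0). unfold radius in *.
    field. lra. }
  assert (Hv1 : forall r, v r th0 = c2).
  { intros r. unfold v. rewrite Hw1. specialize (Kpos r 0). unfold radius in *.
    field. lra. }
  assert (Hdiv : forall r t, 1 < r < 2 -> 0 < t < th0 -> r * fr r t + vt r t = 0).
  { intros r t Hr Ht. destruct (Heul r t Hr Ht) as [_ [_ H]]. unfold fr, vt.
    rewrite K by auto. transitivity (r * (r * ur r t + u r t + wt r t)); [ring|].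
    rewrite H. ring. }
  assert (Pf : forall t, 0 < t < th0 -> f 1 t = f 2 t).
  { intros t _. unfold f. rewrite K1, K2, Pu. ring. }
  assert (Pv : forall t, 0 < t < th0 -> v 1 t = v 2 t).
  { intros t _. unfold v. rewrite K1, K2, Pw. ring. }
  assert (Pvr : forall t, 0 < t < th0 -> vr 1 t = 2 * vr 2 t).
  { intros t _. unfold vr. rewrite K1, K2, Pw, Pwr. ring. }
  assert (Pft := periodic_partial_theta _ _ _ _ Hf Pf).
  assert (PW : forall t, 0 < t < th0 -> W 1 t = W 2 t).
  { intros t Ht. unfold W. rewrite K1, K2, Pvr, Pft by auto. ring. }
  assert (Ec : c1 = c2).
  { apply (edge_fluxes_equal th0 f fr ft v vr vt); auto. }
  split; auto. subst c2. intros Hcase r0 t0 Hrt0.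
  assert (Htr : forall r t, 1 < r < 2 -> 0 < t < th0 ->
     r * f r t * Wr r t + v r t * Wt r t = 2 * f r t * W r t).
  { apply (vorticity_transport th0 P f fr ft v vr vt); auto.
    - intros r t Hr. unfold W. now rewrite K.
    - intros r t Hr Ht. destruct (Heul r t Hr Ht) as [H _].
      eapply is_derive_ext_derive; [exact H|]. unfold f, fr, v, ft.
      rewrite K by auto. field. lra.
    - intros r t Hr Ht. destruct (Heul r t Hr Ht) as [_ [H _]].
      eapply is_derive_ext_derive; [exact H|]. unfold f, vr, v, vt.
      rewrite K by auto. field. lra. }
  (* In the interior [fr = - vt / r], whose right-hand side is of class C1 although
     [fr] is only used as a continuous function; mixed derivatives of [f] agree. *)
  assert (Hdivt : forall r t, 1 < r < 2 -> 0 < t < th0 -> r * ftr r t + vtt r t = 0).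
  { intros r t Hr Ht.
    assert (HA := C1_opp _ _ _ _ (C1_mult _ _ _ _ _ _ _ Hvt
       (C1_inv th0 _ _ _ (C1_radius th0) radius_neq_0))).
    pose proof (mixed_partials th0 f _ _ _ _ _ _ HA Hft) as M. simpl in M.
    rewrite <- M; auto.
    - rewrite K by auto. field. lra.
    - intros r' t' Hr' Ht'. eapply is_derive_ext_derive; [exact (C1_der_r _ _ _ _ Hf r' t' Hr')|].
      specialize (Hdiv r' t' Hr' Ht'). rewrite K by auto.
      replace (vt r' t') with (- (r' * fr r' t')) by lra. field. lra.
    - intros r' t' Hr' Ht'. now apply (C1_der_t _ _ _ _ Hf). }
  assert (Hmix : forall r t, 1 < r < 2 -> 0 < t < th0 -> vrt r t = vtr r t).
  { apply (mixed_partials th0 v vr vrr vrt vt vtr vtt); auto.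
    - intros; now apply (C1_der_r _ _ _ _ Hv).
    - intros; now apply (C1_der_t _ _ _ _ Hv). }
  assert (Hkey : forall r t, 1 < r < 2 -> 0 < t < th0 -> c1 * Wt r t = 2 * f r t * W r t).
  { assert (Hvc : forall r t, v r (clamp 0 th0 t) = v r t).
    { intros r t. unfold v. now rewrite Hwc. }
    (* On an edge [v] is constant, hence [vr = 0] there. *)
    assert (HWe : forall e A, 0 <= e <= th0 -> (forall r, v r e = c1) ->
       (forall r, 1 < r < 2 -> r * ut r e = A) -> forall r, 1 < r < 2 -> W r e = - A).
    { intros e A He Hve HA r Hr. unfold W, ft. rewrite K, HA by auto.
      assert (Evr : vr r e = 0).
      { rewrite <- (is_derive_unique _ _ _ (C1_der_r _ _ _ _ Hv r e Hr)).
        apply is_derive_unique. apply (is_derive_ext (fun _ => c1)).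
        intros; symmetry; apply Hve. apply @is_derive_const. }
      rewrite Evr. ring. }
    destruct (Req_dec c1 0) as [Hc0|Hc0].
    - intros r t Hr Ht.
      assert (HW0 : forall r t, 1 < r < 2 -> 0 < t < th0 -> W r t = 0).
      { apply (vorticity_zero th0 f fr ft v vr vt W Wr Wt (f 0 0)); auto;
          intros; rewrite ?Hv0, ?Hv1; exact Hc0. }
      rewrite HW0, Hc0 by auto. ring.
    - destruct Hcase as [Hcase|[A [HA|HA]]]; [contradiction| |].
      + apply (vorticity_profile th0 f fr ft v vr vt W Wr Wt (f 0 0) c1 A 0); auto.
        apply HWe; auto; try lra. apply Hedge; auto; lra.
      + apply (vorticity_profile th0 f fr ft v vr vt W Wr Wt (f 0 0) c1 A th0); auto.
        apply HWe; auto; try lra. apply Hedge; auto; lra. }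
  assert (Hvc1 : v r0 t0 = c1).
  { apply (angular_rigidity th0 f fr ft ftr ftt v vr vt vrr vrt vtr vtt c1); auto;
      try (now destruct Hrt0).
    intros r t Hr Ht. specialize (Htr r t Hr Ht). specialize (Hkey r t Hr Ht).
    unfold Wr, Wt in *. rewrite K in * by auto. lra. }
  destruct Hrt0 as [Hr0 Ht0]. rewrite Huth by (now split).
  unfold v in Hvc1. rewrite radius_id in Hvc1 by auto.
  rewrite <- Hvc1. field. lra.
Qed.

Lemma derive_zero_const_open f a b :
  (forall x, a < x < b -> is_derive f x 0) ->
  forall x y, a < x < b -> a < y < b -> f x = f y.
Proof.
  intros Hd x y Hx Hy.
  assert (Hm : forall z, Rmin x y <= z <= Rmax x y -> a < z < b).
  { intros z Hz. unfold Rmin, Rmax in Hz. repeat destruct Rle_dec; lra. }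
  destruct (MVT_gen f x y (fun _ => 0)) as [z [_ H]].
  - intros z Hz. apply Hd, Hm. lra.
  - intros z Hz. apply continuity_pt_filterlim.
    apply (@ex_derive_continuous R_AbsRing R_NormedModule).
    exists 0. apply Hd, Hm. lra.
  - lra.
Qed.

(** Once the azimuthal velocity is [c / r], incompressibility makes [r * u_r]
    independent of [r], the azimuthal equation makes the pressure independent of
    the angle, and separating variables in the radial equation gives the
    ordinary differential equation for the profile. *)
Lemma jeffery_hamel_profile th0 uth ur P c :
  0 < th0 ->
  Ck_sector 1 1 2 th0 uth -> Ck_sector 1 1 2 th0 ur ->
  euler_solution 1 2 th0 uth ur P ->
  (forall r t, Omega_closed 1 2 th0 r t -> ur r t <> 0) ->
  (forall r t, Omega_closed 1 2 th0 r t -> uth r t = c / r) ->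
  exists p C : R,
    (forall r t, Omega_closed 1 2 th0 r t -> ur r t = ur 1 t / r) /\
    (forall r t, Omega 1 2 th0 r t -> P r t = p / r ^ 2 + C) /\
    (forall t, 0 <= t <= th0 ->
       c * Derive_on 0 th0 (ur 1) t = ur 1 t ^ 2 + c ^ 2 + 2 * p).
Proof.
  intros Hth Kth Kr HE Hne Hc.
  assert (Hu := C1_extend th0 ur Hth Kr).
  assert (Hw := C1_extend th0 uth Hth Kth).
  assert (Heul := fun r t Hr Ht => polar_euler th0 _ _ P r t _ _ _ _
     (euler_extend _ _ _ _ HE) Hr Ht
     (C1_der_r _ _ _ _ Hw r t Hr) (C1_der_t _ _ _ _ Hw r t Ht)
     (C1_der_r _ _ _ _ Hu r t Hr) (C1_der_t _ _ _ _ Hu r t Ht)).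
  set (u := extend th0 ur) in *. set (w := extend th0 uth) in *.
  set (ux := extend th0 (partial_r 1 2 ur)) in *.
  set (ut := extend th0 (partial_theta th0 ur)) in *.
  set (wx := extend th0 (partial_r 1 2 uth)) in *.
  set (wt := extend th0 (partial_theta th0 uth)) in *.
  assert (Ew : forall r t, 1 <= r <= 2 -> w r t = c / r).
  { intros r t Hr. unfold w, extend. rewrite Hc by now apply clamp_closed.
    now rewrite clamp_id. }
  assert (Ewt : forall r t, 1 < r < 2 -> 0 < t < th0 -> wt r t = 0).
  { intros r t Hr Ht. rewrite <- (is_derive_unique _ _ _ (C1_der_t _ _ _ _ Hw r t Ht)).
    apply is_derive_unique. apply (is_derive_ext (fun _ => c / r)).
    intros s. symmetry. apply Ew. lra. apply @is_derive_const. }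
  assert (Ewx : forall r t, 1 < r < 2 -> wx r t = - c / r ^ 2).
  { intros r t Hr. rewrite <- (is_derive_unique _ _ _ (C1_der_r _ _ _ _ Hw r t Hr)).
    apply is_derive_unique. apply (is_derive_ext_loc (fun s => c / s)).
    - generalize (locally_open_interval 1 2 r Hr). apply filter_imp.
      intros s Hs. symmetry. apply Ew. lra.
    - auto_derive; [lra|]. field. lra. }
  assert (Hf := C1_radius_mult _ _ _ _ Hu).
  assert (Eu : forall r t, 1 <= r <= 2 -> 0 <= t <= th0 -> u r t = u 1 t / r).
  { intros r t Hr Ht.
    apply Rmult_eq_reg_l with r; [|lra].
    apply Rminus_diag_uniq. transitivity (radius r t * u r t - radius 1 t * u 1 t).
    { rewrite !radius_id by lra. field. lra. }
    apply (zero_closure (fun t => radius r t * u r t - radius 1 t * u 1 t) 0 th0); auto.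
    - intros x. apply (@continuous_minus _ _ R_NormedModule).
      + apply (cont2_slice_t (fun r t => radius r t * u r t) r (C1_cont _ _ _ _ Hf)).
      + apply (cont2_slice_t (fun r t => radius r t * u r t) 1 (C1_cont _ _ _ _ Hf)).
    - intros x Hx. apply Rminus_diag_eq.
      apply (derive_zero_const (fun r => radius r x * u r x) 1 2); try lra.
      + apply (cont2_slice_r (fun r t => radius r t * u r t) x (C1_cont _ _ _ _ Hf)).
      + intros s Hs. eapply is_derive_ext_derive; [exact (C1_der_r _ _ _ _ Hf s x Hs)|].
        simpl. rewrite radius_id by lra. destruct (Heul s x Hs Hx) as [_ [_ H]].
        rewrite Ewt in H by auto. lra. }
  assert (Eux : forall r t, 1 < r < 2 -> 0 < t < th0 -> ux r t = - u 1 t / r ^ 2).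
  { intros r t Hr Ht. rewrite <- (is_derive_unique _ _ _ (C1_der_r _ _ _ _ Hu r t Hr)).
    apply is_derive_unique. apply (is_derive_ext_loc (fun s => u 1 t / s)).
    - generalize (locally_open_interval 1 2 r Hr). apply filter_imp.
      intros s Hs. symmetry. apply Eu; lra.
    - auto_derive; [lra|]. field. lra. }
  assert (Eut : forall r t, 1 < r < 2 -> 0 < t < th0 -> ut r t = ut 1 t / r).
  { intros r t Hr Ht. rewrite <- (is_derive_unique _ _ _ (C1_der_t _ _ _ _ Hu r t Ht)).
    apply is_derive_unique. apply (is_derive_ext_loc (fun s => / r * u 1 s)).
    - generalize (locally_open_interval 0 th0 t Ht). apply filter_imp.
      intros s Hs. rewrite (Eu r s) by lra. apply Rmult_comm.
    - eapply is_derive_ext_derive;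
        [apply is_derive_scal; exact (C1_der_t _ _ _ _ Hu 1 t Ht)|]. field. lra. }
  set (q := fun t => u 1 t ^ 2 + c ^ 2 - c * ut 1 t).
  assert (HPr : forall r t, 1 < r < 2 -> 0 < t < th0 ->
     is_derive (fun s => P s t) r (q t / r ^ 3)).
  { intros r t Hr Ht. destruct (Heul r t Hr Ht) as [H _].
    eapply is_derive_ext_derive; [exact H|].
    rewrite Eut, Eux, Ew, (Eu r t) by (auto; lra). unfold q. field. lra. }
  assert (HPt : forall r t, 1 < r < 2 -> 0 < t < th0 -> is_derive (fun s => P r s) t 0).
  { intros r t Hr Ht. destruct (Heul r t Hr Ht) as [_ [H _]].
    eapply is_derive_ext_derive; [exact H|].
    rewrite Ewt, Ewx, Ew by (auto; lra). field. lra. }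
  (* The pressure does not depend on the angle: compare with the middle ray. *)
  set (tm := th0 / 2). assert (Htm : 0 < tm < th0) by (unfold tm; lra).
  assert (EP : forall r t, 1 < r < 2 -> 0 < t < th0 -> P r t = P r tm).
  { intros r t Hr Ht. apply (derive_zero_const_open (P r) 0 th0); auto. }
  assert (Eq : forall t, 0 < t < th0 -> q t = q tm).
  { intros t Ht. assert (Hr : 1 < 3 / 2 < 2) by lra.
    apply Rmult_eq_reg_r with (/ (3 / 2) ^ 3); [|apply Rinv_neq_0_compat; lra].
    change (q t / (3 / 2) ^ 3 = q tm / (3 / 2) ^ 3).
    rewrite <- (is_derive_unique _ _ _ (HPr _ _ Hr Ht)). apply is_derive_unique.
    eapply is_derive_ext_loc; [|exact (HPr _ _ Hr Htm)].
    generalize (locally_open_interval 1 2 _ Hr). apply filter_imp.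
    intros s Hs. symmetry. now apply EP. }
  exists (- q tm / 2), (P (3 / 2) tm + q tm / 2 / (3 / 2) ^ 2).
  split; [|split].
  - intros r t [Hr Ht]. specialize (Eu r t Hr Ht). unfold u in Eu.
    rewrite !extend_eq in Eu by (split; lra). exact Eu.
  - intros r t [Hr Ht]. rewrite EP by auto.
    assert (E : P r tm + q tm / 2 / r ^ 2 = P (3 / 2) tm + q tm / 2 / (3 / 2) ^ 2).
    { apply (derive_zero_const_open (fun s => P s tm + q tm / 2 / s ^ 2) 1 2); try lra.
      intros s Hs. eapply is_derive_ext_derive.
      - apply (is_derive_plus (fun s => P s tm)); [now apply HPr|].
        auto_derive; [|reflexivity]. nra.
      - unfold plus; simpl. field. lra. }
    rewrite <- E. field. lra.
  - intros t Ht.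
    assert (E : c * ut 1 t - u 1 t * u 1 t - c ^ 2 + q tm = 0).
    { apply (zero_closure (fun t => c * ut 1 t - u 1 t * u 1 t - c ^ 2 + q tm) 0 th0); auto.
      - apply (cont2_slice_t (fun r t => c * ut r t - u r t * u r t - c ^ 2 + q tm) 1).
        destruct Hu. cont2_tac.
      - intros x Hx. rewrite <- (Eq x Hx). unfold q. ring. }
    unfold ut, u in E. rewrite !extend_eq in E by (split; lra).
    unfold partial_theta in E. change (fun t0 => ur 1 t0) with (ur 1) in E. lra.
Qed.

Theorem theorem1 :
  forall (theta0 : R) (u_theta u_r P : R -> R -> R) (c1 c2 : R),
  0 < theta0 <= 2 * PI ->
  Ck_sector 2 1 2 theta0 u_theta ->
  Ck_sector 2 1 2 theta0 u_r ->
  euler_solution 1 2 theta0 u_theta u_r P ->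
  (forall r theta, Omega_closed 1 2 theta0 r theta -> Rabs (u_r r theta) > 0) ->
  (forall r, 1 <= r <= 2 -> u_theta r 0 = c1 / r) ->
  (forall r, 1 <= r <= 2 -> u_theta r theta0 = c2 / r) ->
  (forall theta, 0 <= theta <= theta0 ->
     u_r 1 theta = 2 * u_r 2 theta /\
     u_theta 1 theta = 2 * u_theta 2 theta /\
     partial_r 1 2 u_theta 1 theta = 4 * partial_r 1 2 u_theta 2 theta) ->
  c1 = c2 /\
  (c1 = 0 ->
     homogeneous_velocity 1 1 2 theta0 (vfield u_theta u_r) /\
     homogeneous_pressure 1 1 2 theta0 P /\
     exists b C : R,
       b <> 0 /\
       (forall r theta, Omega_closed 1 2 theta0 r theta ->
          vfield u_theta u_r r theta = scal (b / r) (e_r theta)) /\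
       (forall r theta, Omega 1 2 theta0 r theta ->
          P r theta = - (b ^ 2 / (2 * r ^ 2)) + C)) /\
  (c1 <> 0 ->
     (exists A : R,
        (forall r, 1 <= r <= 2 ->
           partial_theta theta0 (fun s t => s * u_r s t) r 0 = A) \/
        (forall r, 1 <= r <= 2 ->
           partial_theta theta0 (fun s t => s * u_r s t) r theta0 = A)) ->
     homogeneous_velocity 1 1 2 theta0 (vfield u_theta u_r) /\
     homogeneous_pressure 1 1 2 theta0 P /\
     exists (v p C : R) (f : R -> R),
       Ck_interval 2 0 theta0 f /\
       strictly_sign_definite (fun theta => 0 <= theta <= theta0) f /\
       (forall r theta, Omega_closed 1 2 theta0 r theta ->
          vfield u_theta u_r r theta =
          plus (scal (v / r) (e_theta theta)) (scal (f theta / r) (e_r theta))) /\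
       (forall r theta, Omega 1 2 theta0 r theta ->
          P r theta = p / r ^ 2 + C) /\
       (forall theta, 0 <= theta <= theta0 ->
          v * Derive_on 0 theta0 f theta = f theta ^ 2 + v ^ 2 + 2 * p)).
Proof.
  intros th0 uth ur P c1 c2 [Hth _] Kth Kr HE Habs Hc1 Hc2 Hper.
  assert (Hne : forall r t, Omega_closed 1 2 th0 r t -> ur r t <> 0).
  { intros r t Hrt E. specialize (Habs r t Hrt). rewrite E, Rabs_R0 in Habs. lra. }
  destruct (azimuthal_velocity_profile th0 uth ur P c1 c2) as [Ec Hcirc]; auto.
  split; auto. clear Hper Habs Hc1 Hc2 Ec c2.
  assert (Kth1 := Ck_sector_pred 1 _ _ _ _ Kth).
  assert (Kr1 := Ck_sector_pred 1 _ _ _ _ Kr).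
  assert (Hsign : forall t, 0 <= t <= th0 -> 0 < ur 1 0 * ur 1 t).
  { intros t Ht.
    assert (H : 0 < extend th0 ur 0 0 * extend th0 ur 1 t).
    { apply nonvanishing_same_sign_2d.
      - apply cont2_extend; auto. apply Kr.
      - intros r s. apply Hne. now apply clamp_closed. }
    unfold extend in H. rewrite !(clamp_id 0), (clamp_id 1 2 1) in H by lra.
    replace (clamp 1 2 0) with 1 in H; auto.
    unfold clamp. rewrite Rmin_right, Rmax_left; lra. }
  assert (Hfield : (forall r t, Omega_closed 1 2 th0 r t -> uth r t = c1 / r) ->
    (forall r t, Omega_closed 1 2 th0 r t -> ur r t = ur 1 t / r) ->
    (forall r t, Omega_closed 1 2 th0 r t -> vfield uth ur r t =
       plus (scal (c1 / r) (e_theta t)) (scal (ur 1 t / r) (e_r t)))).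
  { intros E1 E2 r t Hrt. unfold vfield. now rewrite E1, E2 by exact Hrt. }
  assert (Hhomv : (forall r t, Omega_closed 1 2 th0 r t -> vfield uth ur r t =
       plus (scal (c1 / r) (e_theta t)) (scal (ur 1 t / r) (e_r t))) ->
    homogeneous_velocity 1 1 2 th0 (vfield uth ur)).
  { intros E. exists (fun _ => c1), (ur 1). intros r t Hrt. rewrite E by exact Hrt.
    destruct Hrt. now rewrite Rpower_1 by lra. }
  assert (Hhomp : forall p C, (forall r t, Omega 1 2 th0 r t -> P r t = p / r ^ 2 + C) ->
    homogeneous_pressure 1 1 2 th0 P).
  { intros p C E. exists C, (fun _ => p). intros r t Hrt. rewrite E by exact Hrt.
    destruct Hrt. rewrite Rpower_Ropp. replace (2 * 1) with (INR 2) by (simpl; ring).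
    rewrite Rpower_pow by lra. field. lra. }
  split.
  - intros Hc0. assert (Hw := Hcirc (or_introl Hc0)).
    destruct (jeffery_hamel_profile th0 uth ur P c1) as [p [C [E1 [E2 E3]]]]; auto.
    assert (Hf := Hfield Hw E1).
    split; [now apply Hhomv|]. split; [now apply (Hhomp p C)|].
    exists (ur 1 0), C.
    assert (Econst : forall t, 0 <= t <= th0 -> ur 1 t = ur 1 0).
    { intros t Ht. assert (F1 := E3 t Ht). assert (F0 := E3 0 ltac:(lra)).
      rewrite Hc0 in F0, F1. specialize (Hsign t Ht).
      (* [ur 1 t] and [ur 1 0] have equal squares and the same sign. *)
      assert (F : (ur 1 t - ur 1 0) * (ur 1 t + ur 1 0) = 0) by nra.
      apply Rmult_integral in F. destruct F as [F|F]; [lra|]. nra. }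
    split; [apply Hne; split; lra|]. split.
    + intros r t Hrt. rewrite Hf by exact Hrt. destruct Hrt as [Hr Ht].
      rewrite Econst, Hc0 by exact Ht.
      unfold Rdiv at 1. rewrite Rmult_0_l.
      refine (eq_trans (f_equal (fun x => plus x _) (scal_zero_l (e_theta t))) _).
      apply plus_zero_l.
    + intros r t Hrt. rewrite E2 by exact Hrt.
      assert (F0 := E3 0 ltac:(lra)). rewrite Hc0 in F0.
      replace p with (- (ur 1 0 ^ 2) / 2) by lra. destruct Hrt. field. lra.
  - intros Hc0 HA. assert (Hw := Hcirc (or_intror HA)).
    destruct (jeffery_hamel_profile th0 uth ur P c1) as [p [C [E1 [E2 E3]]]]; auto.
    assert (Hf := Hfield Hw E1).
    split; [now apply Hhomv|]. split; [now apply (Hhomp p C)|].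
    exists c1, p, C, (ur 1).
    split; [|split; [|now split]].
    + apply (Ck_sector_slice 2); auto; lra.
    + assert (H0 := Hsign 0 ltac:(lra)).
      destruct (Rlt_dec 0 (ur 1 0)) as [Hpos|Hneg]; [left|right];
        intros t Ht; specialize (Hsign t Ht); nra.
Qed.
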